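(* Consider the problem \textsc{ConRMC}: given a finite alphabet $\Sigma$, an incomplete matrix $\mathbf{S} \in (\Sigma \cup \{*\})^{n \times \ell}$ and nonnegative integers $d_1, \dots, d_n$, decide whether there is a vector $v \in \Sigma^\ell$ such that $\delta(v, \mathbf{S}[i]) \le d_i$ for each $i \in [n]$. Let $d = \max_{i \in [n]} d_i$ and let $k$ be the maximum number of missing entries in any row of $\mathbf{S}$. Then \textsc{ConRMC} can be solved in $O(n\ell + (d+1)^{d+k+1} n)$ time.
   Context: The symbol $*$ denotes a missing entry and is not in $\Sigma$. $\mathbf{S}[i]$ denotes the $i$-th row. For $v, v' \in (\Sigma \cup \{*\})^\ell$, $\delta(v,v')$ is the number of positions $j$ with $v[j] \ne v'[j]$, $v[j]\ne *$ and $v'[j]\ne *$. $[n]=\{1,\dots,n\}$. *)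

(* Defs.v *)
From HB Require Import structures.
From mathcomp Require Import all_boot all_order all_algebra.

Set Implicit Arguments.
Unset Strict Implicit.
Unset Printing Implicit Defensive.

(** * Word RAM

  Running times are counted on a unit-cost word RAM: a finite program operating
  on registers and on a random-access memory, all of whose cells hold [w]-bit
  words. *)

Inductive instr :=
  | Const of nat & nat          (* Const i a    : r_i := a                   *)
  | Add of nat & nat & nat      (* Add i j k    : r_i := r_j + r_k           *)
  | Sub of nat & nat & nat      (* Sub i j k    : r_i := r_j - r_k, or 0     *)
  | Mul of nat & nat & nat      (* Mul i j k    : r_i := r_j * r_k           *)
  | Read of nat & nat           (* Read i j     : r_i := mem[r_j]            *)
  | Write of nat & nat          (* Write i j    : mem[r_i] := r_j            *)
  | Jump of nat                 (* Jump a       : goto a                     *)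
  | JumpLt of nat & nat & nat   (* JumpLt i j a : if r_i < r_j then goto a   *)
  | Halt.

Definition program := seq instr.

Record config := Config { pc : nat; reg : nat -> nat; mem : nat -> nat }.

(* Leaving the program text counts as halting. *)
Definition fetch (p : program) (c : config) : instr := nth Halt p (pc c).

Definition halted (p : program) (c : config) : bool :=
  if fetch p c is Halt then true else false.

(* A halted configuration is a fixed point. *)
Definition step (w : nat) (p : program) (c : config) : config :=
  let: Config q r m := c in
  match fetch p c with
  | Const i a => Config q.+1 [eta r with i |-> a %% 2 ^ w] m
  | Add i j k => Config q.+1 [eta r with i |-> (r j + r k) %% 2 ^ w] m
  | Sub i j k => Config q.+1 [eta r with i |-> r j - r k] m
  | Mul i j k => Config q.+1 [eta r with i |-> (r j * r k) %% 2 ^ w] m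
  | Read i j => Config q.+1 [eta r with i |-> m (r j)] m
  | Write i j => Config q.+1 r [eta m with r i |-> r j]
  | Jump a => Config a r m
  | JumpLt i j a => Config (if r i < r j then a else q.+1) r m
  | Halt => c
  end.

(* The input occupies the initial memory cells; everything else is zero. *)
Definition init (x : seq nat) : config :=
  Config 0 (fun=> 0) (fun a => nth 0 x a).

Definition run (w : nat) (p : program) (x : seq nat) (t : nat) : config :=
  iter t (step w p) (init x).

(* The answer, 1 for yes and 0 for no, is left in register 0. *)
Definition decides_within (w : nat) (p : program) (x : seq nat) (b : bool)
    (T : nat) : Prop :=
  exists2 t, t <= T & halted p (run w p x t) /\ reg (run w p x t) 0 = b.

Definition magnitude (x : seq nat) : nat := maxn (size x) (\max_(a <- x) a).

(* The problem [Q] on the instance type [I], with instances presented through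
   [enc], is solvable in time O(f).  One program serves all instances.  As usual
   for a word RAM, words have at least [e * log N] bits for a constant [e], where
   [N] bounds both the length of the input and the numbers in it; the time bound
   does not depend on the word size. *)
Definition solvable_in_bigO (I : Type) (enc : I -> seq nat) (Q : I -> bool)
    (f : I -> nat) : Prop :=
  exists (p : program) (e C : nat), forall (x : I) (w : nat),
    magnitude (enc x) ^ e < 2 ^ w ->
    decides_within w p (enc x) (Q x) (C * f x).

(** * The problem ConRMC

  [None] is the missing entry. *)

Definition delta (Sigma : finType) (l : nat) (v v' : 'rV[option Sigma]_l) : nat :=
  #|[set j | [&& v ord0 j != v' ord0 j, v ord0 j != None & v' ord0 j != None]]|.

(* There is at least one row: otherwise the maximum of the radii is undefined. *)
Record instance := Instance {
  alphabet : finType;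
  nrows : nat;
  ncols : nat;
  matrixS : 'M[option alphabet]_(nrows, ncols);
  radius : 'I_nrows -> nat;
  nrows_gt0 : 0 < nrows
}.

Definition con_rmc (X : instance) : bool :=
  [exists v : 'rV[alphabet X]_(ncols X), [forall i : 'I_(nrows X),
     delta (map_mx Some v) (row i (matrixS X)) <= radius i]].

Definition max_radius (X : instance) : nat :=
  \max_(i < nrows X) radius i.

Definition max_missing (X : instance) : nat :=
  \max_(i < nrows X) #|[set j | matrixS X i j == None]|.

Definition encode_entry (Sigma : finType) (a : option Sigma) : nat :=
  if a is Some b then (enum_rank b).+1 else 0.

(* n, l, |Sigma|, then d_1, ..., d_n, then the matrix row by row. *)
Definition encode (X : instance) : seq nat :=
  [:: nrows X; ncols X; #|alphabet X|]
    ++ [seq radius i | i <- enum 'I_(nrows X)]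
    ++ [seq encode_entry (matrixS X i j)
         | i <- enum 'I_(nrows X), j <- enum 'I_(ncols X)].

(* Main.v *)
(* Start from [v = S[1]] with the missing entries filled by an arbitrary symbol.
   A solution [u] differs from [v] in at most [d_1 + k] positions.  While some row
   [i] is at distance more than [d_i] from [v], take [d_i + 1] positions where
   they differ: [u] agrees with [S[i]] on one of them, so setting [v] to [S[i]]
   there decreases the Hamming distance to [u].  Branching over the [d_i + 1]
   choices gives a search tree of depth at most [d_1 + k] and degree at most
   [d + 1].  Each node costs only O(n + d): every row keeps the set of its
   mismatches with [v] as a sparse set (a permutation of the columns, its inverse
   and a size), which supports insertion, deletion and listing [d_i + 1] members
   in constant time per element.  When [d = 0] the tree is a path with at most
   [l + 1] nodes.

   The search is written in a small while language whose programs are compiled to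
   the word RAM with a constant-factor slowdown. *)

Require Import Defs.
From HB Require Import structures.
From mathcomp Require Import all_boot all_order all_algebra.
From mathcomp Require Import zify.

Set Implicit Arguments.
Unset Strict Implicit.
Unset Printing Implicit Defensive.

(** * A structured language and its compilation *)

(** The language has no calls, so the recursion runs as one flat loop with an explicit stack, and
    the tree argument is recovered by reading the exploration of a subtree as a stretch of loop
    iterations. Undoing a branch restores every mismatch set, but possibly not the order in which
    its members are stored. Hence the branching positions are copied to the stack before descending,
    and all invariants speak of the sets only. The depth limit D is d_1 plus the number of missing
    entries of the first row; an exhausted subtree with b levels left certifies that no solution
    lies within Hamming distance b of its node. The sum of node costs is geometric, of order n
    (d+1)^(D+1), only for d > 0; for d = 0 that power is 1 and the search is charged to the term n
    l. The word size matters because arithmetic must not wrap: the arrays are two-dimensional, so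
    addresses are quadratic in the magnitude of the input. *)

Inductive expr :=
  | Var of nat
  | Cst of nat
  | Plus of expr & expr
  | Minus of expr & expr
  | Get of nat & expr & expr
  | Inp of expr.

Inductive cmd :=
  | Skip
  | Assign of nat & expr
  | Put of nat & expr & expr & expr
  | Seq of cmd & cmd
  | If of expr & expr & cmd & cmd
  | While of expr & expr & cmd.

Record state := State {vars : nat -> nat; arrs : nat -> nat -> nat -> nat}.

Definition setv (s : state) (x v : nat) : state :=
  State (fun y => if eqn y x then v else vars s y) (arrs s).

Definition seta (s : state) (a i j v : nat) : state :=
  State (vars s)
    (fun b => if eqn b a then
       fun i' j' => if (i' == i) && (j' == j) then v else arrs s a i' j'
     else arrs s b).

Definition state0 : state := State (fun=> 0) (fun _ _ _ => 0).

Section Semantics.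

Variables (X : seq nat) (L : nat).

Fixpoint eval (s : state) (e : expr) : nat :=
  match e with
  | Var x => vars s x
  | Cst a => a
  | Plus e1 e2 => eval s e1 + eval s e2
  | Minus e1 e2 => eval s e1 - eval s e2
  | Get a e1 e2 => arrs s a (eval s e1) (eval s e2)
  | Inp e1 => nth 0 X (eval s e1)
  end.

(* The second index of an array is bounded by the length of the input, which
   serves as the row stride when arrays are laid out in memory. *)
Fixpoint safe (s : state) (e : expr) : Prop :=
  match e with
  | Var _ | Cst _ => True
  | Plus e1 e2 => [/\ safe s e1, safe s e2 & eval s e1 + eval s e2 < L]
  | Minus e1 e2 => safe s e1 /\ safe s e2
  | Get a e1 e2 =>
      [/\ safe s e1, safe s e2, eval s e1 < L & eval s e2 < size X]
  | Inp e1 => safe s e1 /\ eval s e1 < size X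
  end.

(** Evaluating an expression is covered by the unit charged to the statement or test that contains
    it, since its size is fixed by the program. Unsafe states have no rule, so a derivation also
    certifies that nothing overflows and no access is out of range. *)
Inductive exec : cmd -> state -> state -> nat -> Prop :=
  | ExecSkip s : exec Skip s s 0
  | ExecAssign x e s :
      safe s e -> exec (Assign x e) s (setv s x (eval s e)) 1
  | ExecPut a e1 e2 e3 s :
      safe s (Get a e1 e2) -> safe s e3 ->
      exec (Put a e1 e2 e3) s
           (seta s a (eval s e1) (eval s e2) (eval s e3)) 1
  | ExecSeq c1 c2 s1 s2 s3 t1 t2 :
      exec c1 s1 s2 t1 -> exec c2 s2 s3 t2 ->
      exec (Seq c1 c2) s1 s3 (t1 + t2)
  | ExecIf e1 e2 c1 c2 s s' t :
      safe s e1 -> safe s e2 ->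
      exec (if eval s e1 < eval s e2 then c1 else c2) s s' t ->
      exec (If e1 e2 c1 c2) s s' t.+1
  | ExecWhileT e1 e2 c s1 s2 s3 t1 t2 :
      safe s1 e1 -> safe s1 e2 -> eval s1 e1 < eval s1 e2 ->
      exec c s1 s2 t1 -> exec (While e1 e2 c) s2 s3 t2 ->
      exec (While e1 e2 c) s1 s3 (t1 + t2).+1
  | ExecWhileF e1 e2 c s :
      safe s e1 -> safe s e2 -> eval s e2 <= eval s e1 ->
      exec (While e1 e2 c) s s 1.

End Semantics.

Section Compiler.

Variables (nv na : nat).

(* Register 0 holds 0 and register 1 the length of the input. *)
Definition vreg (x : nat) : nat := x.+2.
Definition treg (k : nat) : nat := nv.+2 + k.

(* Arrays are interleaved behind the input. *)
Definition address (N a i j : nat) : nat := (i * N + j) * na + N + a.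

Definition comp_address (k a : nat) : seq instr :=
  [:: Mul (treg k) (treg k) 1; Add (treg k) (treg k) (treg k.+1);
      Const (treg k.+1) na; Mul (treg k) (treg k) (treg k.+1);
      Add (treg k) (treg k) 1; Const (treg k.+1) a;
      Add (treg k) (treg k) (treg k.+1)].

(** Temporaries form an evaluation stack: the value ends in [treg k] and lower registers are kept.
    Subtracting register 0, which holds 0, acts as a move. *)
Fixpoint comp_expr (k : nat) (e : expr) : seq instr :=
  match e with
  | Var x => [:: Defs.Sub (treg k) (vreg x) 0]
  | Cst a => [:: Const (treg k) a]
  | Plus e1 e2 => comp_expr k e1 ++ comp_expr k.+1 e2
                    ++ [:: Add (treg k) (treg k) (treg k.+1)]
  | Minus e1 e2 => comp_expr k e1 ++ comp_expr k.+1 e2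
                    ++ [:: Defs.Sub (treg k) (treg k) (treg k.+1)]
  | Get a e1 e2 => comp_expr k e1 ++ comp_expr k.+1 e2
                    ++ comp_address k a ++ [:: Read (treg k) (treg k)]
  | Inp e1 => comp_expr k e1 ++ [:: Read (treg k) (treg k)]
  end.

Definition comp_test (e1 e2 : expr) : seq instr :=
  comp_expr 0 e1 ++ comp_expr 1 e2.

(** Jump targets are absolute, so the position [q] of the code is a parameter. In [If] the else
    branch comes first, where a failed [JumpLt] falls through. *)
Fixpoint comp_cmd (q : nat) (c : cmd) : seq instr :=
  match c with
  | Skip => [::]
  | Assign x e => comp_expr 0 e ++ [:: Defs.Sub (vreg x) (treg 0) 0]
  | Put a e1 e2 e3 =>
      comp_expr 0 e3 ++ comp_expr 1 e1 ++ comp_expr 2 e2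
        ++ comp_address 1 a ++ [:: Write (treg 1) (treg 0)]
  | Seq c1 c2 =>
      let s1 := comp_cmd q c1 in s1 ++ comp_cmd (q + size s1) c2
  | If e1 e2 c1 c2 =>
      let s := comp_test e1 e2 in
      let s2 := comp_cmd (q + size s).+1 c2 in
      let q1 := ((q + size s).+1 + size s2).+1 in
      let s1 := comp_cmd q1 c1 in
      s ++ JumpLt (treg 0) (treg 1) q1 :: s2 ++ Jump (q1 + size s1) :: s1
  | While e1 e2 c1 =>
      let s := comp_test e1 e2 in
      let s1 := comp_cmd (q + size s).+2 c1 in
      s ++ [:: JumpLt (treg 0) (treg 1) (q + size s).+2;
               Jump ((q + size s).+2 + size s1).+1]
        ++ s1 ++ [:: Jump q]
  end.

Fixpoint wf_expr (B : nat) (e : expr) : bool :=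
  match e with
  | Var x => x < nv
  | Cst a => a < B
  | Plus e1 e2 | Minus e1 e2 => wf_expr B e1 && wf_expr B e2
  | Get a e1 e2 => [&& a < na, wf_expr B e1 & wf_expr B e2]
  | Inp e1 => wf_expr B e1
  end.

Fixpoint wf (B : nat) (c : cmd) : bool :=
  match c with
  | Skip => true
  | Assign x e => (x < nv) && wf_expr B e
  | Put a e1 e2 e3 => [&& a < na, wf_expr B e1, wf_expr B e2 & wf_expr B e3]
  | Seq c1 c2 => wf B c1 && wf B c2
  | If e1 e2 c1 c2 => [&& wf_expr B e1, wf_expr B e2, wf B c1 & wf B c2]
  | While e1 e2 c1 => [&& wf_expr B e1, wf_expr B e2 & wf B c1]
  end.

(** * Simulation of the structured language by compiled code *)

Variables (X : seq nat) (L w : nat) (p : program).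

Let N := size X.

Hypothesis word_large : (L * N).+1 * na + N + na <= 2 ^ w.
Hypothesis wordL : L <= 2 ^ w.

Definition code_at (q : nat) (s : seq instr) : Prop :=
  forall i, i < size s -> nth Halt p (q + i) = nth Halt s i.

Lemma code_at_cat q s1 s2 :
  code_at q (s1 ++ s2) -> code_at q s1 /\ code_at (q + size s1) s2.
Proof.
move=> H; split=> i Hi.
  by rewrite H ?size_cat ?ltn_addr // nth_cat Hi.
rewrite -addnA H ?size_cat ?ltn_add2l // nth_cat.
by rewrite ltnNge leq_addr /= addKn.
Qed.

Lemma code_at_cons q i s :
  code_at q (i :: s) -> nth Halt p q = i /\ code_at q.+1 s.
Proof.
rewrite -cat1s => /code_at_cat[H1 H2]; split; last by rewrite -addn1.
by have := H1 0 isT; rewrite addn0.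
Qed.

Definition reaches (t : nat) (c c' : config) : Prop :=
  iter t (step w p) c = c'.

Lemma reaches_trans t1 t2 c1 c2 c3 :
  reaches t1 c1 c2 -> reaches t2 c2 c3 -> reaches (t1 + t2) c1 c3.
Proof. by rewrite /reaches addnC iterD => -> ->. Qed.

Definition linear_step (i : instr) (rm : (nat -> nat) * (nat -> nat)) :
    (nat -> nat) * (nat -> nat) :=
  let: (r, m) := rm in
  match i with
  | Const i a => ([eta r with i |-> a %% 2 ^ w] : nat -> nat, m)
  | Add i j k => ([eta r with i |-> (r j + r k) %% 2 ^ w] : nat -> nat, m)
  | Defs.Sub i j k => ([eta r with i |-> r j - r k] : nat -> nat, m)
  | Mul i j k => ([eta r with i |-> (r j * r k) %% 2 ^ w] : nat -> nat, m)
  | Read i j => ([eta r with i |-> m (r j)] : nat -> nat, m)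
  | Write i j => (r, [eta m with r i |-> r j] : nat -> nat)
  | _ => rm
  end.

Definition linear (i : instr) : bool :=
  match i with Jump _ | JumpLt _ _ _ | Halt => false | _ => true end.

Lemma linear_reaches s q r m :
  code_at q s -> all linear s ->
  let rm := foldl (fun rm i => linear_step i rm) (r, m) s in
  reaches (size s) (Config q r m) (Config (q + size s) rm.1 rm.2).
Proof.
elim: s q r m => [|i s IH] q r m; first by rewrite /= addn0.
case/code_at_cons=> Hi Hs /andP[li ls].
have Hst : step w p (Config q r m) =
   let rm := linear_step i (r, m) in Config q.+1 rm.1 rm.2.
  by rewrite /step /fetch /= Hi; case: i li {Hi}.
have {IH} := IH q.+1 (linear_step i (r, m)).1 (linear_step i (r, m)).2 Hs ls.
by rewrite -surjective_pairing /reaches iterSr Hst addSnnS.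
Qed.

Definition represents (s : state) (r m : nat -> nat) : Prop :=
  [/\ r 0 = 0, r 1 = N, (forall x, x < nv -> r (vreg x) = vars s x),
      (forall a, a < N -> m a = nth 0 X a) &
      (forall a i j, a < na -> j < N -> m (address N a i j) = arrs s a i j)].

Lemma represents_temp k s r r' m :
  represents s r m -> (forall x, x < treg k -> r' x = r x) ->
  represents s r' m.
Proof.
case=> r0 r1 rv mi ma H; split=> //; try by rewrite H.
by move=> x xv; rewrite H ?rv // /vreg /treg; lia.
Qed.

(** Up to the shift by [N], an address is a mixed-radix numeral: its residue modulo [na] is the
    array, and the quotient has digits [i] and [j] in base [N]. *)
Lemma address_inj a i j a' i' j' :
  a < na -> j < N -> a' < na -> j' < N ->
  address N a i j = address N a' i' j' -> [/\ a = a', i = i' & j = j'].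
Proof.
rewrite /address => Ha Hj Ha' Hj' E.
have E1 : (i * N + j) * na + a = (i' * N + j') * na + a' by lia.
have Ea : a = a'.
  by have := congr1 (modn^~ na) E1; rewrite !modnMDl !modn_small.
have Eij : i * N + j = i' * N + j'.
  have := congr1 (divn^~ na) E1.
  by rewrite !divnMDl ?divn_small ?addn0 //; lia.
have Ej : j = j'.
  by have := congr1 (modn^~ N) Eij; rewrite !modnMDl !modn_small.
have Ei : i = i'.
  have := congr1 (divn^~ N) Eij.
  by rewrite !divnMDl ?divn_small ?addn0 //; lia.
by [].
Qed.

Lemma address_bound a i j :
  a < na -> i < L -> j < N -> address N a i j < 2 ^ w.
Proof.
rewrite /address => Ha Hi Hj; apply: leq_trans word_large.
have : i * N + j < (L * N).+1 by nia.
by move=> H; have := leq_mul H (leqnn na); nia.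
Qed.

Lemma comp_address_reaches k a i j q r m :
  a < na -> i < L -> j < N ->
  r 1 = N -> r (treg k) = i -> r (treg k.+1) = j ->
  code_at q (comp_address k a) ->
  exists r', [/\ reaches 7 (Config q r m) (Config (q + 7) r' m),
    r' (treg k) = address N a i j &
    forall x, x < treg k -> r' x = r x].
Proof.
move=> Ha Hi Hj r1 ri rj Hc; have Hb := address_bound Ha Hi Hj.
have t1 : treg k.+1 == treg k = false by rewrite /treg; lia.
have t2 : treg k == treg k.+1 = false by rewrite /treg; lia.
have t3 : 1 == treg k = false by rewrite /treg; lia.
have t4 : 1 == treg k.+1 = false by rewrite /treg; lia.
have := @linear_reaches _ q r m Hc isT.
rewrite [foldl _ _ _]/= => H; eexists; split; first exact: H.
  rewrite /= !(eqxx, t1, t2, t3, t4) r1 ri rj.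
  have Hna : na < 2 ^ w.
    by apply: leq_trans word_large; rewrite mulSn; lia.
  have H3 : (i * N + j) * na + N + a < 2 ^ w by [].
  have H2 : i * N + j < 2 ^ w.
    by nia.
  (* Every running value is at most the final address, so no reduction modulo [2 ^ w] takes
     effect. *)
  rewrite !(@modn_small na) // !(@modn_small a) ?(ltn_trans Ha) //.
  rewrite !(@modn_small (i * N)); last by lia.
  rewrite !(@modn_small (_ + j)) //.
  rewrite !(@modn_small (_ * na)); last by lia.
  by rewrite !(@modn_small (_ + N)) ?modn_small //; lia.
move=> x xk /=.
have -> : x == treg k = false by lia.
by have -> : x == treg k.+1 = false by move: xk; rewrite /treg; lia.
Qed.

Definition expr_correct (e : expr) : Prop := forall k s q r m,
  wf_expr (2 ^ w) e -> safe X L s e -> represents s r m ->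
  code_at q (comp_expr k e) ->
  exists r', [/\
    reaches (size (comp_expr k e)) (Config q r m)
      (Config (q + size (comp_expr k e)) r' m),
    r' (treg k) = eval X s e & forall x, x < treg k -> r' x = r x].

Lemma comp_expr_reaches e : expr_correct e.
Proof.
have tempS k' x : x < treg k' -> x < treg k'.+1 by rewrite /treg; lia.
have neq k' x : x < treg k' -> (x == treg k') = false by lia.
(* Shared by the two-operand cases: the first value waits in [treg k] while the second operand uses
   [treg k.+1] and above. *)
have bin e1 e2 : expr_correct e1 -> expr_correct e2 ->
    forall c k s q r m, wf_expr (2 ^ w) e1 -> wf_expr (2 ^ w) e2 ->
      safe X L s e1 -> safe X L s e2 -> represents s r m ->
      code_at q (comp_expr k e1 ++ comp_expr k.+1 e2 ++ c) ->
      let sz := size (comp_expr k e1) + size (comp_expr k.+1 e2) in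
      exists r', [/\ reaches sz (Config q r m) (Config (q + sz) r' m),
        r' (treg k) = eval X s e1, r' (treg k.+1) = eval X s e2,
        (forall x, x < treg k -> r' x = r x) & code_at (q + sz) c].
  move=> IH1 IH2 c k1 s1 q1 r1 m1 w1 w2 f1 f2 Hr.
  case/code_at_cat=> C1 /code_at_cat[C2 C3].
  have [r2 [R2 E2 F2]] := IH1 k1 s1 q1 r1 m1 w1 f1 Hr C1.
  have Hr2 : represents s1 r2 m1 by exact: represents_temp Hr F2.
  have [r3 [R3 E3 F3]] := IH2 k1.+1 s1 _ r2 m1 w2 f2 Hr2 C2.
  exists r3; split => //.
  - by rewrite addnA; apply: reaches_trans R2 R3.
  - by rewrite F3 // /treg; lia.
  - by move=> x Hx; rewrite F3 ?F2 // tempS.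
  - by rewrite addnA.
elim: e => [x|a|e1 IH1 e2 IH2|e1 IH1 e2 IH2|a e1 IH1 e2 IH2|e1 IH1]
  k s q r m /=.
- move=> xv _ [r0 r1 rv mi ma] C.
  have := @linear_reaches _ q r m C isT; rewrite [foldl _ _ _]/= => H.
  eexists; split; first exact: H.
    by rewrite /= eqxx rv // r0 subn0.
  by move=> y yk; rewrite /= neq.
- move=> aB _ _ C.
  have := @linear_reaches _ q r m C isT; rewrite [foldl _ _ _]/= => H.
  eexists; split; first exact: H.
    by rewrite /= eqxx modn_small.
  by move=> y yk; rewrite /= neq.
- case/andP=> w1 w2 [f1 f2 fL] Hr C.
  have [r' [R' E1 E2 F C']] := bin _ _ IH1 IH2 _ _ _ _ _ _ w1 w2 f1 f2 Hr C.
  have := @linear_reaches _ _ r' m C' isT; rewrite [foldl _ _ _]/= => H.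
  eexists; split.
  + by rewrite !size_cat !addnA -(addnA q); apply: reaches_trans R' H.
  + by rewrite /= eqxx E1 E2 modn_small // (leq_trans fL).
  + by move=> y yk; rewrite /= neq ?F.
- case/andP=> w1 w2 [f1 f2] Hr C.
  have [r' [R' E1 E2 F C']] := bin _ _ IH1 IH2 _ _ _ _ _ _ w1 w2 f1 f2 Hr C.
  have := @linear_reaches _ _ r' m C' isT; rewrite [foldl _ _ _]/= => H.
  eexists; split.
  + by rewrite !size_cat !addnA -(addnA q); apply: reaches_trans R' H.
  + by rewrite /= eqxx E1 E2.
  + by move=> y yk; rewrite /= neq ?F.
- case/and3P=> Ha w1 w2 [f1 f2 f3 f4] Hr C.
  have [r' [R' E1 E2 F C']] := bin _ _ IH1 IH2 _ _ _ _ _ _ w1 w2 f1 f2 Hr C.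
  case: (Hr) => r0 r1 rv mi ma.
  have r1' : r' 1 = N by rewrite F ?r1 // /treg; lia.
  have [C1 C2] := @code_at_cat _ (comp_address k a) [:: Read (treg k) (treg k)] C'.
  have [r2 [R2 G2 F2]] := comp_address_reaches m Ha f3 f4 r1' E1 E2 C1.
  have := @linear_reaches _ _ r2 m C2 isT; rewrite [foldl _ _ _]/= => H.
  eexists; split.
  + rewrite !size_cat [size [:: _, _ & _]]/=.
    have -> : size (comp_expr k e1) + (size (comp_expr k.+1 e2) + 8) =
      size (comp_expr k e1) + size (comp_expr k.+1 e2) + 7 + 1 by lia.
    rewrite 2!(addnA q); apply: reaches_trans H.
    exact: reaches_trans R' R2.
  + by rewrite /= eqxx G2 ma.
  + by move=> y yk; rewrite /= neq // F2 ?F.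
- move=> w1 [f1 f2] Hr /code_at_cat[C1 C2].
  have [r' [R' E1 F1]] := IH1 k s q r m w1 f1 Hr C1.
  have := @linear_reaches _ _ r' m C2 isT; rewrite [foldl _ _ _]/= => H.
  eexists; split.
  + by rewrite size_cat addnA; apply: reaches_trans R' H.
  + by rewrite /= eqxx E1; case: Hr => _ _ _ ->.
  + by move=> y yk; rewrite /= neq ?F1.
Qed.

Lemma comp_test_reaches e1 e2 s q r m c :
  wf_expr (2 ^ w) e1 -> wf_expr (2 ^ w) e2 -> safe X L s e1 -> safe X L s e2 ->
  represents s r m -> code_at q (comp_test e1 e2 ++ c) ->
  exists r', [/\ reaches (size (comp_test e1 e2)) (Config q r m)
      (Config (q + size (comp_test e1 e2)) r' m),
    r' (treg 0) = eval X s e1, r' (treg 1) = eval X s e2, represents s r' m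
    & code_at (q + size (comp_test e1 e2)) c].
Proof.
move=> w1 w2 f1 f2 Hr; rewrite /comp_test => /code_at_cat[/code_at_cat[C1 C2] C3].
have [r1 [R1 E1 F1]] := comp_expr_reaches w1 f1 Hr C1.
have Hr1 := represents_temp Hr F1.
have [r2 [R2 E2 F2]] := comp_expr_reaches w2 f2 Hr1 C2.
exists r2; split=> //.
- by rewrite size_cat addnA; apply: reaches_trans R1 R2.
- by rewrite F2 // /treg; lia.
- exact: represents_temp Hr1 F2.
Qed.

Lemma represents_setv s r m x v :
  represents s r m -> x < nv ->
  represents (setv s x v) [eta r with vreg x |-> v] m.
Proof.
case=> r0 r1 rv mi ma Hx; split=> // y Hy /=.
have -> : (vreg y == vreg x) = eqn y x by [].
by case: eqn; rewrite ?rv.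
Qed.

Lemma represents_seta s r m a i j v :
  represents s r m -> a < na -> j < N ->
  represents (seta s a i j v) r [eta m with address N a i j |-> v].
Proof.
case=> r0 r1 rv mi ma Ha Hj; split=> // [b Hb | b i' j' Hb Hj'] /=.
  by rewrite ifN ?mi //; apply/negP; rewrite /address => /eqP; lia.
case: eqP => [/address_inj[] // -> -> ->|E]; first by rewrite eqnE !eqxx.
rewrite ma // eqnE; case: (eqVneq b a) => // Eb; subst b.
by case: andP => // -[/eqP ? /eqP ?]; subst.
Qed.

(** One unit of cost pays for the instructions of one assignment, or of one test with its jumps;
    these belong to the code of the command, so there are at most [K]. Keeping [K] free in the
    induction lets sub-commands be charged at the rate of the whole program. *)
Lemma comp_reaches c s s' t : exec X L c s s' t ->
  forall q r m K, wf (2 ^ w) c -> represents s r m -> code_at q (comp_cmd q c) ->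
  size (comp_cmd q c) <= K ->
  exists r' m' t', [/\
    reaches t' (Config q r m) (Config (q + size (comp_cmd q c)) r' m'),
    represents s' r' m' & t' <= K * t].
Proof.
elim=> {c s s' t}.
- by move=> s q r m K _ Hr _ _; exists r, m, 0; rewrite addn0.
- move=> x e s f q r m K /= /andP[Hx we] Hr /code_at_cat[C1 C2] HK.
  have [r1 [R1 E1 F1]] := comp_expr_reaches we f Hr C1.
  have R2 := @linear_reaches _ _ r1 m C2 isT.
  have Hr1 := represents_temp Hr F1.
  exists [eta r1 with vreg x |-> eval X s e], m, (size (comp_expr 0 e) + 1).
  split.
  + rewrite size_cat addnA; apply: reaches_trans R1 _.
    have r10 : r1 0 = 0 by case: Hr1.
    by move: R2; rewrite /= E1 r10 subn0.
  + exact: represents_setv.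
  + by rewrite muln1; move: HK; rewrite size_cat.
- move=> a e1 e2 e3 s [f1 f2 b1 b2] f3 q r m K /= /and4P[Ha w1 w2 w3] Hr.
  case/code_at_cat=> C1 /code_at_cat[C2] /code_at_cat[C3] C4 HK.
  have [C5 C6] := @code_at_cat _ (comp_address 1 a) [:: Write (treg 1) (treg 0)] C4.
  have [r1 [R1 E1 F1]] := comp_expr_reaches w3 f3 Hr C1.
  have Hr1 := represents_temp Hr F1.
  have [r2 [R2 E2 F2]] := comp_expr_reaches w1 f1 Hr1 C2.
  have Hr2 : represents s r2 m by exact: represents_temp Hr1 F2.
  have [r3 [R3 E3 F3]] := comp_expr_reaches w2 f2 Hr2 C3.
  have Hr3 : represents s r3 m by exact: represents_temp Hr2 F3.
  have r31 : r3 1 = N by case: Hr3.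
  have E2' : r3 (treg 1) = eval X s e1 by rewrite F3 // /treg; lia.
  have [r4 [R4 E4 F4]] := comp_address_reaches m Ha b1 b2 r31 E2' E3 C5.
  have Hr4 : represents s r4 m by exact: represents_temp Hr3 F4.
  have R5 := @linear_reaches _ _ r4 m C6 isT.
  have E1' : r4 (treg 0) = eval X s e3.
    by rewrite F4 ?F3 ?F2 // /treg; lia.
  exists r4, [eta m with address N a (eval X s e1) (eval X s e2) |-> eval X s e3].
  exists (size (comp_expr 0 e3) +
            (size (comp_expr 1 e1) + (size (comp_expr 2 e2) + (7 + 1)))).
  split.
  + rewrite !size_cat [size [:: _, _ & _]]/=.
    rewrite -[8]/(7 + 1).
    rewrite (addnA q); apply: reaches_trans R1 _.
    rewrite (addnA (q + _)); apply: reaches_trans R2 _.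
    rewrite (addnA (q + _ + _)); apply: reaches_trans R3 _.
    rewrite (addnA (q + _ + _ + _)); apply: reaches_trans R4 _.
    by move: R5; rewrite /= E4 E1'.
  + exact: represents_seta.
  + by rewrite muln1; move: HK; rewrite !size_cat.
- move=> c1 c2 s1 s2 s3 t1 t2 _ IH1 _ IH2 q r m K /= /andP[w1 w2] Hr.
  case/code_at_cat=> C1 C2; rewrite size_cat => HK.
  have [|r1 [m1 [u1 [R1 Hr1 H1]]]] := IH1 q r m K w1 Hr C1; first by lia.
  have [|r2 [m2 [u2 [R2 Hr2 H2]]]] := IH2 _ r1 m1 K w2 Hr1 C2; first by lia.
  exists r2, m2, (u1 + u2); split=> //; last by rewrite mulnDr leq_add.
  by rewrite addnA; apply: reaches_trans R1 R2.
- move=> e1 e2 c1 c2 s s' t f1 f2 _ IH q r m K /= /and4P[w1 w2 w3 w4] Hr C.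
  have [r1 [R1 E1 E2 Hr1 C']] := comp_test_reaches w1 w2 f1 f2 Hr C.
  move: C' => /code_at_cons[CJ] /code_at_cat[C2 /code_at_cons[CK C1]].
  rewrite size_cat /= size_cat /= => HK.
  have S1 : step w p (Config (q + size (comp_test e1 e2)) r1 m) =
    Config (if eval X s e1 < eval X s e2 then
       ((q + size (comp_test e1 e2)).+1 +
           size (comp_cmd (q + size (comp_test e1 e2)).+1 c2)).+1
       else (q + size (comp_test e1 e2)).+1) r1 m.
    by rewrite /step /fetch /= CJ E1 E2.
  move: IH S1; case: ltnP => _ IH S1.
  + have [|r2 [m2 [u2 [R2 Hr2 H2]]]] := IH _ r1 m K w3 Hr1 C1; first by lia.
    exists r2, m2, (size (comp_test e1 e2) + (1 + u2)); split=> //;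
      last by rewrite mulnS; lia.
    apply: (reaches_trans R1); apply: (reaches_trans (t1 := 1) S1).
    by move: R2; congr (reaches _ _ (Config _ _ _)); lia.
  + have [|r2 [m2 [u2 [R2 Hr2 H2]]]] := IH _ r1 m K w4 Hr1 C2; first by lia.
    exists r2, m2, (size (comp_test e1 e2) + (1 + (u2 + 1))); split=> //;
      last by rewrite mulnS; lia.
    apply: (reaches_trans R1); apply: (reaches_trans (t1 := 1) S1).
    apply: (reaches_trans R2).
    by rewrite /reaches /= /fetch /= CK; congr Config; lia.
- move=> e1 e2 c s1 s2 s3 t1 t2 f1 f2 Hlt _ IH1 _ IH2 q r m K Hw Hr C HK.
  move: (Hw) (C) (HK) => /= /and3P[w1 w2 w3] C' HK'.
  have [r1 [R1 E1 E2 Hr1 C3]] := comp_test_reaches w1 w2 f1 f2 Hr C'.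
  move: C3 => /code_at_cons[CJ] /code_at_cons[CK] /code_at_cat[C4 /code_at_cons[CL _]].
  move: HK'; rewrite size_cat /= (size_cat (comp_cmd _ _)) /= => HK'.
  have S1 : step w p (Config (q + size (comp_test e1 e2)) r1 m) =
     Config (q + size (comp_test e1 e2)).+2 r1 m.
    by rewrite /step /fetch /= CJ E1 E2 Hlt.
  have [|r2 [m2 [u2 [R2 Hr2 H2]]]] := IH1 _ r1 m K w3 Hr1 C4; first by lia.
  have [r3 [m3 [u3 [R3 Hr3 H3]]]] := IH2 q r2 m2 K Hw Hr2 C HK.
  exists r3, m3, (size (comp_test e1 e2) + (1 + (u2 + (1 + u3)))); split=> //.
  + apply: (reaches_trans R1). apply: (reaches_trans (t1 := 1) S1).
    apply: (reaches_trans R2).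
    move: R3; rewrite /= size_cat /= (size_cat (comp_cmd _ _)) /= => R3.
    apply: (reaches_trans (t1 := 1) _ R3).
    by rewrite /reaches /= /fetch /= CL.
  + by rewrite mulnS mulnDr; lia.
- move=> e1 e2 c s f1 f2 Hge q r m K /= /and3P[w1 w2 w3] Hr C.
  have [r1 [R1 E1 E2 Hr1 C3]] := comp_test_reaches w1 w2 f1 f2 Hr C.
  move: C3 => /code_at_cons[CJ] /code_at_cons[CK] _.
  rewrite size_cat /= (size_cat (comp_cmd _ _)) /= => HK.
  exists r1, m, (size (comp_test e1 e2) + 2); split=> //; last by lia.
  apply: (reaches_trans R1).
  rewrite /reaches /= /fetch /= CJ E1 E2 ltnNge Hge /= /fetch /= CK.
  by congr Config; lia.
Qed.

End Compiler.

(** The machine is not told the length of its input; it is computed as n l + n + 3 from the first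
    two cells and put into register 1. *)
Definition prologue (nv : nat) : seq instr :=
  let t0 := treg nv 0 in let t1 := treg nv 1 in
  [:: Const t0 0; Read t0 t0; Const t1 1; Read t1 t1; Mul t1 t0 t1;
      Add 1 t0 t1; Const t0 3; Add 1 1 t0].

(** The offset 8 is the length of the prologue. The last subtraction moves variable 0, the answer,
    into register 0. *)
Definition compile (nv na : nat) (c : cmd) : program :=
  prologue nv ++ comp_cmd nv na 8 c ++ [:: Defs.Sub 0 (vreg 0) 0; Halt].

Lemma compile_decides nv na c X L w s t (b : bool) :
  size X = 3 + nth 0 X 0 + nth 0 X 0 * nth 0 X 1 ->
  0 < nv -> wf nv na (2 ^ w) c ->
  (L * size X).+1 * na + size X + na <= 2 ^ w -> L <= 2 ^ w -> size X < 2 ^ w ->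
  exec X L c state0 s t -> vars s 0 = b ->
  decides_within w (compile nv na c) X b (size (compile nv na c) * t.+1).
Proof.
move=> HX nv0 Hwf Hw HL HXw He Hb.
set p := compile nv na c; set K := size (comp_cmd nv na 8 c).
have Hp : code_at p 0
    (prologue nv ++ comp_cmd nv na 8 c ++ [:: Defs.Sub 0 (vreg 0) 0; Halt]).
  by move=> i _.
case/code_at_cat: Hp => P1 /code_at_cat[P2 /code_at_cons[P3 /code_at_cons[P4 _]]].
have {}P2 : code_at p 8 (comp_cmd nv na 8 c) by [].
have {P3 P4} [P3 P4] : nth Halt p (8 + K) = Defs.Sub 0 (vreg 0) 0 /\
    nth Halt p (8 + K).+1 = Halt by [].
pose r1 := (foldl (fun rm i => linear_step w i rm)
              (fun=> 0, nth 0 X) (prologue nv)).1.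
have R1 : reaches w p 8 (init X) (Config 8 r1 (nth 0 X)).
  exact: (linear_reaches w (fun=> 0) (nth 0 X) P1 isT).
have r1E : forall x, r1 x = if x == 1 then size X else if x == treg nv 0 then 3
    else if x == treg nv 1 then nth 0 X 0 * nth 0 X 1 else 0.
  have e1 : (treg nv 0 == treg nv 1) = false by rewrite /treg; lia.
  have e2 : (1 == treg nv 0) = false by rewrite /treg; lia.
  have e3 : (1 == treg nv 1) = false by rewrite /treg; lia.
  have e4 : (treg nv 0 == 1) = false by rewrite /treg; lia.
  have e5 : (treg nv 1 == 1) = false by rewrite /treg; lia.
  have e6 : (treg nv 1 == treg nv 0) = false by rewrite /treg; lia.
  move=> x; rewrite /r1 /= !(eqxx, e1, e2, e3, e4, e5, e6, mod0n).
  have m1 : 1 %% 2 ^ w = 1 by rewrite modn_small //; lia.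
  have m3 : 3 %% 2 ^ w = 3 by rewrite modn_small //; lia.
  rewrite m1 m3 !(@modn_small (nth 0 X 0 * _)); try lia.
  rewrite !(@modn_small (nth 0 X 0 + _)); try lia.
  rewrite !(@modn_small (_ + 3)); try lia.
  rewrite {1}HX; case: (eqVneq x 1) => [_|_]; first by lia.
  by case: (x == treg nv 0) => //; case: (x == treg nv 1).
clearbody r1.
have H0 : represents nv na X state0 r1 (nth 0 X).
  split=> //.
  - by move=> x Hx; rewrite r1E /vreg /treg /=; do 2 (case: eqP => ?; first lia).
  (* Arrays start behind the input, where memory is initially zero, as in [state0]. *)
  - by move=> a i j Ha Hj; rewrite nth_default // /address; lia.
have [r2 [m2 [t2 [R2 [z _ rv _ _] Ht2]]]] :=
  comp_reaches Hw HL He Hwf H0 P2 (leqnn _).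
exists (8 + (t2 + 1)).
  rewrite /p /compile !size_cat /= -/K; move: Ht2; rewrite -/K; nia.
have R3 : run w p X (8 + (t2 + 1)) =
  Config (8 + K).+1 [eta r2 with 0 |-> r2 (vreg 0) - r2 0] m2.
  apply: (reaches_trans R1); apply: (reaches_trans R2).
  have F : fetch p (Config (8 + K) r2 m2) = Defs.Sub 0 (vreg 0) 0 by [].
  by rewrite /reaches /= /step F.
have F : fetch p (run w p X (8 + (t2 + 1))) = Halt by rewrite R3.
by rewrite /halted F R3 /= rv // z subn0 Hb.
Qed.

Lemma wf_expr_mono nv na B B' e : B <= B' -> wf_expr nv na B e -> wf_expr nv na B' e.
Proof.
move=> HB; elim: e => [//|a|e1 IH1 e2 IH2|e1 IH1 e2 IH2|a e1 IH1 e2 IH2|//] /=.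
- by move=> H; apply: leq_trans H HB.
- by case/andP=> /IH1-> /IH2->.
- by case/andP=> /IH1-> /IH2->.
- by case/and3P=> -> /IH1-> /IH2->.
Qed.

(** Lets well-formedness of a concrete program be computed for a small bound on its constants and
    then lifted to [2 ^ w]. *)
Lemma wf_mono nv na B B' c : B <= B' -> wf nv na B c -> wf nv na B' c.
Proof.
move=> HB; have He e := @wf_expr_mono nv na B B' e HB.
elim: c => [//|x e|a e1 e2 e3|c1 IH1 c2 IH2|e1 e2 c1 IH1 c2 IH2|e1 e2 c IH] /=.
- by case/andP=> -> /He.
- by case/and4P=> -> /He-> /He-> /He->.
- by case/andP=> /IH1-> /IH2->.
- by case/and4P=> /He-> /He-> /IH1-> /IH2->.
- by case/and3P=> /He-> /He-> /IH->.
Qed.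


(** * Cost-annotated weakest preconditions *)

Fixpoint modv (c : cmd) : seq nat :=
  match c with
  | Skip | Put _ _ _ _ => [::]
  | Assign x _ => [:: x]
  | Seq c1 c2 | If _ _ c1 c2 => modv c1 ++ modv c2
  | While _ _ c1 => modv c1
  end.

Fixpoint moda (c : cmd) : seq nat :=
  match c with
  | Skip | Assign _ _ => [::]
  | Put a _ _ _ => [:: a]
  | Seq c1 c2 | If _ _ c1 c2 => moda c1 ++ moda c2
  | While _ _ c1 => moda c1
  end.

Definition frame (c : cmd) (s s' : state) : Prop :=
  (forall x, x \notin modv c -> vars s' x = vars s x) /\
  (forall a, a \notin moda c -> arrs s' a = arrs s a).

Definition For (x y : nat) (c : cmd) : cmd :=
  While (Var x) (Var y) (Seq c (Assign x (Plus (Var x) (Cst 1)))).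

Section WP.

Variables (X : seq nat) (L : nat).

Lemma exec_frame c s s' t : exec X L c s s' t -> frame c s s'.
Proof.
elim=> {c s s' t} //=.
- move=> x e s _; split=> //= y; rewrite inE eqnE.
  by case: (y == x).
- move=> a e1 e2 e3 s _ _; split=> //= b; rewrite inE eqnE.
  by case: (b == a).
- move=> c1 c2 s1 s2 s3 t1 t2 _ [V1 A1] _ [V2 A2]; split=> x /=;
    by rewrite mem_cat negb_or => /andP[H1 H2]; rewrite ?V2 ?V1 ?A2 ?A1.
- move=> e1 e2 c1 c2 s s' t _ _ _ [V A]; split=> x /=;
    rewrite mem_cat negb_or => /andP[H1 H2]; first rewrite V //; try rewrite A //;
    by case: ifP.
- move=> e1 e2 c s1 s2 s3 t1 t2 _ _ _ _ [V1 A1] _ [V2 A2]; split=> x /= H;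
    by rewrite ?V2 ?V1 ?A2 ?A1.
Qed.

(** Total correctness with an accumulator: [k] is the cost already spent and [Q] receives the new
    total. *)
Definition wp (c : cmd) (s : state) (k : nat) (Q : state -> nat -> Prop) : Prop :=
  exists s' t, exec X L c s s' t /\ Q s' (k + t).

Lemma wp_skip s k (Q : state -> nat -> Prop) : Q s k -> wp Skip s k Q.
Proof. by exists s, 0; split; [constructor | rewrite addn0]. Qed.

Lemma wp_assign x e s k (Q : state -> nat -> Prop) :
  safe X L s e -> Q (setv s x (eval X s e)) k.+1 -> wp (Assign x e) s k Q.
Proof.
by move=> f q; exists (setv s x (eval X s e)), 1; split; [constructor | rewrite addn1].
Qed.

Lemma wp_put a e1 e2 e3 s k (Q : state -> nat -> Prop) :
  safe X L s (Get a e1 e2) -> safe X L s e3 ->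
  Q (seta s a (eval X s e1) (eval X s e2) (eval X s e3)) k.+1 ->
  wp (Put a e1 e2 e3) s k Q.
Proof.
move=> f g q; exists (seta s a (eval X s e1) (eval X s e2) (eval X s e3)), 1.
by split; [constructor | rewrite addn1].
Qed.

Lemma wp_seq c1 c2 s k (Q : state -> nat -> Prop) :
  wp c1 s k (fun s' k' => wp c2 s' k' Q) -> wp (Seq c1 c2) s k Q.
Proof.
move=> [s1 [t1 [H1 [s2 [t2 [H2 q]]]]]]; exists s2, (t1 + t2).
by split; [apply: ExecSeq H1 H2 | rewrite addnA].
Qed.

Lemma wp_if e1 e2 c1 c2 s k (Q : state -> nat -> Prop) :
  safe X L s e1 -> safe X L s e2 ->
  (eval X s e1 < eval X s e2 -> wp c1 s k.+1 Q) ->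
  (eval X s e2 <= eval X s e1 -> wp c2 s k.+1 Q) ->
  wp (If e1 e2 c1 c2) s k Q.
Proof.
move=> f1 f2 H1 H2.
have [s' [t [H q]]] :
    wp (if eval X s e1 < eval X s e2 then c1 else c2) s k.+1 Q.
  by case: ltnP => H; [apply: H1 | apply: H2].
by exists s', t.+1; split; [constructor | rewrite addnS -addSn].
Qed.

(** Specifications may start from another cost [k0], and the frame comes for free, so they need not
    list what stays unchanged. *)
Lemma wp_conseq c s k k0 (Q R : state -> nat -> Prop) :
  wp c s k0 R ->
  (forall s' t, R s' (k0 + t) -> frame c s s' -> Q s' (k + t)) -> wp c s k Q.
Proof.
move=> [s' [t [H r]]] HQ; exists s', t; split=> //.
by apply: HQ r _; apply: exec_frame H.
Qed.

(** Each round adds 2 to the cost of the body, for the test and the increment; the final 1 is the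
    failing test. The frame is available in every round, so [I] need only mention what the loop
    changes. *)
Lemma wp_for x y c s k (Q : state -> nat -> Prop) (I : nat -> state -> Prop) m T :
  x \notin modv c -> y \notin x :: modv c ->
  vars s x = 0 -> vars s y = m -> m < L -> I 0 s ->
  (forall i s1, i < m -> I i s1 -> vars s1 x = i -> vars s1 y = m ->
     frame (For x y c) s s1 ->
     wp c s1 0 (fun s2 k2 => I i.+1 (setv s2 x i.+1) /\ k2 <= T)) ->
  (forall s' t, I m s' -> vars s' x = m -> frame (For x y c) s s' ->
     t <= m * (T + 2) + 1 -> Q s' (k + t)) ->
  wp (For x y c) s k Q.
Proof.
rewrite inE negb_or => Hx /andP[yx Hy] sx sy mL I0 Hb HQ.
suff [s' [t [He HI Hx' Ht]]] : exists s' t, [/\ exec X L (For x y c) s s' t,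
    I m s', vars s' x = m & t <= m * (T + 2) + 1].
  by exists s', t; split=> //; apply: HQ => //; apply: exec_frame He.
have loop k1 i s1 : k1 + i = m -> I i s1 -> vars s1 x = i -> vars s1 y = m ->
   frame (For x y c) s s1 ->
   exists s' t, [/\ exec X L (For x y c) s1 s' t,
    I m s', vars s' x = m & t <= k1 * (T + 2) + 1].
  elim: k1 i s1 => [|k1 IH] i s1 Hk Ii s1x s1y Hf.
    rewrite add0n in Hk; rewrite Hk in Ii s1x; exists s1, 1; split=> //.
    by apply: ExecWhileF => //=; rewrite s1x s1y.
  have im : i < m by lia.
  have [s2 [t2 [H2 [I2 Ht2]]]] := Hb i s1 im Ii s1x s1y Hf.
  have [V2 A2] := exec_frame H2.
  have s2x : vars s2 x = i by rewrite V2.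
  have He : exec X L (Seq c (Assign x (Plus (Var x) (Cst 1)))) s1
      (setv s2 x i.+1) (t2 + 1).
    apply: ExecSeq H2 _.
    have -> : i.+1 = eval X s2 (Plus (Var x) (Cst 1)) by rewrite /= s2x addn1.
    by constructor; split=> //=; rewrite s2x; lia.
  have [||||s' [t [H HI Hx' Ht]]] := IH i.+1 (setv s2 x i.+1) _ I2.
  - by lia.
  - by rewrite /= eqnE eqxx.
  - by rewrite /= eqnE (negPf yx) V2.
  - have [V3 A3] := exec_frame He; case: Hf => V4 A4.
    by split=> z Hz; [rewrite V3 ?V4 | rewrite A3 ?A4].
  exists s', (t2 + 1 + t).+1; split=> //; last by rewrite mulSn; lia.
  by apply: ExecWhileT He H => //=; rewrite s1x s1y.
by apply: (loop m 0); rewrite ?addn0 //; split.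
Qed.

(** Unfinished runs of a loop. Unlike [exec] of the loop they compose, so a subtree of the search
    can be analysed as a segment. *)
Inductive iters (e1 e2 : expr) (c : cmd) : state -> state -> nat -> Prop :=
  | Iters0 s : iters e1 e2 c s s 0
  | ItersS s1 s2 s3 t1 t2 :
      safe X L s1 e1 -> safe X L s1 e2 -> eval X s1 e1 < eval X s1 e2 ->
      exec X L c s1 s2 t1 -> iters e1 e2 c s2 s3 t2 ->
      iters e1 e2 c s1 s3 (t1 + t2).+1.

Lemma iters_trans e1 e2 c s1 s2 s3 t1 t2 :
  iters e1 e2 c s1 s2 t1 -> iters e1 e2 c s2 s3 t2 ->
  iters e1 e2 c s1 s3 (t1 + t2).
Proof.
elim=> {s1 s2 t1} // s1 s2 s4 u1 u2 f1 f2 lt He _ IH /IH H.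
by rewrite addSn -addnA; apply: ItersS He H.
Qed.

Lemma iters_exec e1 e2 c s s' t :
  iters e1 e2 c s s' t -> safe X L s' e1 -> safe X L s' e2 ->
  eval X s' e2 <= eval X s' e1 -> exec X L (While e1 e2 c) s s' t.+1.
Proof.
elim=> {s s' t} [s|s1 s2 s3 t1 t2 f1 f2 lt He _ IH] g1 g2 ge.
  exact: ExecWhileF.
by rewrite -addnS; apply: ExecWhileT He _ => //; apply: IH.
Qed.

End WP.

(** * Vectors, mismatches and sparse sets *)

Section Search.

Variables (n l sg : nat) (S : nat -> nat -> nat) (d : nat -> nat).

(* Symbols are 1, ..., sg; the missing entry is 0. *)
Definition miss (v : nat -> nat) (i j : nat) : bool :=
  (S i j != 0) && (S i j != v j).

Definition dist (v : nat -> nat) (i : nat) : nat := #|[set j : 'I_l | miss v i j]|.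

Definition ham (u v : nat -> nat) : nat := #|[set j : 'I_l | u j != v j]|.

Definition valid (v : nat -> nat) : Prop := forall j, j < l -> 0 < v j <= sg.

Definition solution (v : nat -> nat) : Prop :=
  valid v /\ forall i, i < n -> dist v i <= d i.

Definition nosol (b : nat) (v : nat -> nat) : Prop :=
  forall u, solution u -> ham u v <= b -> False.

Definition upd (v : nat -> nat) (j x : nat) : nat -> nat :=
  fun y => if y == j then x else v y.

Lemma dist_ext u v i : (forall j, j < l -> u j = v j) -> dist u i = dist v i.
Proof.
by move=> E; congr #|pred_of_set _|; apply/setP=> j; rewrite !inE /miss E.
Qed.

Lemma nosol0 v i : i < n -> d i < dist v i -> nosol 0 v.
Proof.
move=> Hi Hd u [_ /(_ i Hi)]; rewrite /ham leqn0 cards_eq0 => Hu /eqP/setP E.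
move: Hd; rewrite ltnNge -(@dist_ext u v) ?Hu // => j Hj.
by have := E (Ordinal Hj); rewrite !inE => /negbFE/eqP.
Qed.

Lemma ham_upd u v j : j < l -> u j != v j -> ham u v = (ham u (upd v j (u j))).+1.
Proof.
move=> Hj Huv; rewrite /ham (cardsD1 (Ordinal Hj)) inE Huv add1n.
congr #|pred_of_set _|.+1; apply/setP=> x; rewrite !inE /upd -val_eqE /=.
by case: eqP => //= ->; rewrite eqxx.
Qed.

(** If [u] differed from row [i] at all the listed positions, these would be [d i + 1] distinct
    mismatches of [u] itself, against its being a solution. *)
Lemma nosol_branch b v i (ps : nat -> nat) :
  i < n ->
  (forall c, c <= d i -> ps c < l /\ miss v i (ps c)) ->
  (forall c c', c <= d i -> c' <= d i -> ps c = ps c' -> c = c') ->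
  (forall c, c <= d i -> nosol b (upd v (ps c) (S i (ps c)))) ->
  nosol b.+1 v.
Proof.
move=> Hi Hps Hinj Hb u Hu Hham.
case: (boolP [exists c : 'I_(d i).+1, u (ps c) == S i (ps c)]) =>
  [/existsP[c /eqP Hc]|].
  have Hcd : c <= d i by rewrite -ltnS.
  have [pl /andP[_ pm]] := Hps c Hcd.
  apply: (Hb c Hcd u Hu); rewrite -Hc.
  by move: Hham; rewrite (ham_upd pl) ?Hc.
rewrite negb_exists => /forallP H.
have Hl (c : 'I_(d i).+1) : ps c < l by have [] := Hps c (ltn_ord c : c <= d i).
have /subset_leq_card : [set Ordinal (Hl c) | c : 'I_(d i).+1]
    \subset [set j : 'I_l | miss u i j].
  apply/subsetP=> _ /imsetP[c _ ->]; rewrite inE /= /miss.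
  have [_ /andP[-> _]] := Hps c (ltn_ord c : c <= d i).
  by rewrite eq_sym H.
rewrite card_imset ?card_ord => [Hc|c c' /(congr1 val) /= E].
  by have := Hu.2 i Hi; rewrite leqNgt Hc.
by apply/val_inj; apply: Hinj E; rewrite -ltnS.
Qed.

(* Sparse sets: the members are the entries of [A] before index [m], and [P] is
   the inverse of the permutation [A]. *)
Definition bij (A P : nat -> nat) : Prop :=
  (forall x, x < l -> A x < l /\ P (A x) = x) /\
  (forall j, j < l -> P j < l /\ A (P j) = j).

Definition sset (A P : nat -> nat) (m : nat) (E : pred nat) : Prop :=
  [/\ bij A P, m <= l & forall j, j < l -> (P j < m) = E j].

Lemma sset_ext A P m E A' P' m' E' :
  A' =1 A -> P' =1 P -> m' = m -> (forall j, j < l -> E' j = E j) ->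
  sset A P m E -> sset A' P' m' E'.
Proof.
move=> EA EP -> EE [[B1 B2] Hm HE]; split=> //.
  by split=> x Hx; rewrite !(EA, EP); [apply: B1|apply: B2].
by move=> j Hj; rewrite EP HE ?EE.
Qed.

(** Element [j] trades slots with the occupant of slot [q]: the last member for a deletion, the
    first non-member for an insertion. The nesting of the tests mirrors the order of the writes in
    [swap], where later writes win. *)
Lemma bij_swap A P j q :
  bij A P -> j < l -> q < l ->
  bij (fun x => if x == q then j else if x == P j then A q else A x)
      (fun x => if x == j then q else if x == A q then P j else P x).
Proof.
move=> [B1 B2] Hj Hq; have [Pj APj] := B2 j Hj; have [Aq PAq] := B1 q Hq.
split=> x Hx; have [Ax PAx] := B1 x Hx; have [Px APx] := B2 x Hx.
  case: (eqVneq x q) => [->|xq]; first by rewrite eqxx.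
  case: (eqVneq x (P j)) => [E|xP].
    case: eqVneq => [E'|_]; last by rewrite eqxx E.
    by rewrite E -E' PAq eqxx in xq.
  case: eqVneq => [E|_]; first by rewrite -E PAx eqxx in xP.
  by case: eqVneq => [E|//]; rewrite -PAx E PAq eqxx in xq.
case: (eqVneq x j) => [->|xj]; first by rewrite eqxx.
case: (eqVneq x (A q)) => [E|xA].
  case: eqVneq => [E'|_]; last by rewrite eqxx E.
  by rewrite E -E' APj eqxx in xj.
case: eqVneq => [E|_]; first by rewrite -E APx eqxx in xA.
by case: eqVneq => [E|//]; rewrite -APx E APj eqxx in xj.
Qed.

Lemma sset_remove A P q E j :
  sset A P q.+1 E -> j < l -> P j < q.+1 ->
  sset (fun x => if x == q then j else if x == P j then A q else A x)
       (fun x => if x == j then q else if x == A q then P j else P x) q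
       (fun x => if x == j then false else E x).
Proof.
move=> [B Hm HE] Hj HP; split; [exact: bij_swap | by lia |].
case: B => B1 B2 x Hx; have [Px APx] := B2 x Hx; have [Aq PAq] := B1 q Hm.
have [Pj APj] := B2 j Hj.
case: (eqVneq x j) => [_|xj]; first by rewrite ltnn.
rewrite -HE //; case: (eqVneq x (A q)) => [E'|xA].
  rewrite E' PAq; have : P j <> q by move=> Eq; rewrite E' -Eq APj eqxx in xj.
  by lia.
by have : P x <> q by [move=> Eq; rewrite -Eq APx eqxx in xA]; lia.
Qed.

Lemma sset_insert A P q E j :
  sset A P q E -> j < l -> q <= P j ->
  sset (fun x => if x == q then j else if x == P j then A q else A x)
       (fun x => if x == j then q else if x == A q then P j else P x) q.+1
       (fun x => if x == j then true else E x).
Proof.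
move=> [B Hm HE] Hj HP; have [Pj APj] := B.2 j Hj.
have Hq : q < l by lia.
split; [exact: bij_swap | by [] |].
case: B => B1 B2 x Hx; have [Px APx] := B2 x Hx; have [Aq PAq] := B1 q Hq.
case: (eqVneq x j) => [_|xj]; first by rewrite ltnSn.
rewrite -HE //; case: (eqVneq x (A q)) => [E'|xA].
  rewrite E' PAq; have : P j <> q by move=> Eq; rewrite E' -Eq APj eqxx in xj.
  by lia.
by have : P x <> q by [move=> Eq; rewrite -Eq APx eqxx in xA]; lia.
Qed.

(** Makes the stored size of a row equal to its distance, so that a violation is detected in
    constant time. *)
Lemma sset_card A P m E : sset A P m E -> m = #|[set j : 'I_l | E j]|.
Proof.
move=> [[B1 B2] Hm HE].
have Hx (x : 'I_m) : A x < l by have [] := B1 x (leq_trans (ltn_ord x) Hm).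
have -> : [set j : 'I_l | E j] = [set Ordinal (Hx x) | x : 'I_m].
  apply/setP=> j; rewrite inE -HE //; apply/idP/imsetP => [Pj|[x _ ->]].
    by exists (Ordinal Pj) => //; apply/val_inj; case: (B2 j (ltn_ord j)).
  by have [_ /= ->] := B1 x (leq_trans (ltn_ord x) Hm).
rewrite card_imset ?card_ord // => x y /(congr1 (fun z : 'I_l => P z)) /=.
have [_ ->] := B1 x (leq_trans (ltn_ord x) Hm).
have [_ ->] := B1 y (leq_trans (ltn_ord y) Hm).
exact: val_inj.
Qed.

End Search.

(** * The search program *)

(* [vMode] is 0 to visit a node, 1 to move to the next branch and 2 to stop. *)
Notation vAns := 0 (only parsing).
Notation vN := 1 (only parsing).
Notation vL := 2 (only parsing).
Notation vSg := 3 (only parsing).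
Notation vI := 4 (only parsing).
Notation vJ := 5 (only parsing).
Notation vP := 6 (only parsing).
Notation vD := 7 (only parsing).
Notation vT := 8 (only parsing).
Notation vMode := 9 (only parsing).
Notation vS := 10 (only parsing).
Notation vX := 11 (only parsing).
Notation vQ := 12 (only parsing).
Notation vY := 13 (only parsing).
Notation vR := 14 (only parsing).
Notation vC := 15 (only parsing).
Notation vLen := 16 (only parsing).

(* [aA], [aP] and [aM] hold the sparse set of each row.  The last five arrays are
   the stack: at each level, the positions to branch on, the violated row, the
   index of the current branch, the number of branches and the symbol that the
   current branch has overwritten. *)
Notation aS := 0 (only parsing).
Notation aD := 1 (only parsing).
Notation aV := 2 (only parsing).
Notation aA := 3 (only parsing).
Notation aP := 4 (only parsing).
Notation aM := 5 (only parsing).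
Notation aList := 6 (only parsing).
Notation aRow := 7 (only parsing).
Notation aCnt := 8 (only parsing).
Notation aLen := 9 (only parsing).
Notation aOld := 10 (only parsing).

Fixpoint block (cs : seq cmd) : cmd :=
  if cs is c :: cs' then Seq c (block cs') else Skip.

Notation Get1 a e := (Get a e (Cst 0)).
Notation Put1 a e e' := (Put a e (Cst 0) e').

Definition swap : cmd := block [::
  Assign vY (Get aA (Var vI) (Var vQ));
  Put aA (Var vI) (Var vP) (Var vY);
  Put aP (Var vI) (Var vY) (Var vP);
  Put aA (Var vI) (Var vQ) (Var vJ);
  Put aP (Var vI) (Var vJ) (Var vQ)].

(** [vC] records whether column [vJ] must be in the mismatch set of row [vI] under the new symbol
    [vS]. The only test is [<], so disequality takes two comparisons. *)
Definition update_row : cmd := block [::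
  Assign vX (Get aS (Var vI) (Var vJ));
  Assign vP (Get aP (Var vI) (Var vJ));
  Assign vQ (Get1 aM (Var vI));
  Assign vC (Cst 0);
  If (Cst 0) (Var vX)
     (If (Var vX) (Var vS) (Assign vC (Cst 1))
        (If (Var vS) (Var vX) (Assign vC (Cst 1)) Skip)) Skip;
  If (Cst 0) (Var vC)
     (If (Var vP) (Var vQ) Skip
        (Seq swap (Put1 aM (Var vI) (Plus (Var vQ) (Cst 1)))))
     (If (Var vP) (Var vQ)
        (Seq (Assign vQ (Minus (Var vQ) (Cst 1)))
             (Seq swap (Put1 aM (Var vI) (Var vQ)))) Skip)].

Definition update : cmd := block [::
  Put1 aV (Var vJ) (Var vS);
  Assign vI (Cst 0);
  For vI vN update_row].

(** At the depth limit the level keeps zero branches, so [advance] treats it as already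
    exhausted. *)
Definition visit : cmd := block [::
  Assign vR (Var vN);
  Assign vI (Cst 0);
  For vI vN (If (Get1 aD (Var vI)) (Get1 aM (Var vI)) (Assign vR (Var vI)) Skip);
  If (Var vR) (Var vN)
    (block [::
       Put1 aLen (Var vT) (Cst 0);
       Put1 aCnt (Var vT) (Cst 0);
       Assign vMode (Cst 1);
       If (Var vT) (Var vD)
         (block [::
            Assign vLen (Plus (Get1 aD (Var vR)) (Cst 1));
            Assign vC (Cst 0);
            For vC vLen (Put aList (Var vT) (Var vC) (Get aA (Var vR) (Var vC)));
            Put1 aRow (Var vT) (Var vR);
            Put1 aLen (Var vT) (Var vLen)])
         Skip])
    (block [:: Assign vAns (Cst 1); Assign vMode (Cst 2)])].

(** The branch counter of a level grows only on the way back up: while a child is explored it still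
    points to the position to be restored. *)
Definition advance : cmd :=
  If (Get1 aCnt (Var vT)) (Get1 aLen (Var vT))
    (block [::
       Assign vJ (Get aList (Var vT) (Get1 aCnt (Var vT)));
       Put1 aOld (Var vT) (Get1 aV (Var vJ));
       Assign vS (Get aS (Get1 aRow (Var vT)) (Var vJ));
       update;
       Assign vT (Plus (Var vT) (Cst 1));
       Assign vMode (Cst 0)])
    (If (Cst 0) (Var vT)
       (block [::
          Assign vT (Minus (Var vT) (Cst 1));
          Assign vJ (Get aList (Var vT) (Get1 aCnt (Var vT)));
          Assign vS (Get1 aOld (Var vT));
          update;
          Put1 aCnt (Var vT) (Plus (Get1 aCnt (Var vT)) (Cst 1))])
       (Assign vMode (Cst 2))).

Definition search : cmd := If (Var vMode) (Cst 1) visit advance.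

Definition next_input (c : expr -> cmd) : cmd :=
  Seq (c (Inp (Var vP))) (Assign vP (Plus (Var vP) (Cst 1))).

Definition read_input : cmd := block [::
  Assign vN (Inp (Cst 0)); Assign vL (Inp (Cst 1)); Assign vSg (Inp (Cst 2));
  Assign vP (Cst 3);
  Assign vI (Cst 0);
  For vI vN (next_input (Put aD (Var vI) (Cst 0)));
  Assign vI (Cst 0);
  For vI vN (block [::
    Assign vJ (Cst 0);
    For vJ vL (block [::
      next_input (Put aS (Var vI) (Var vJ));
      Put aA (Var vI) (Var vJ) (Var vJ);
      Put aP (Var vI) (Var vJ) (Var vJ)])])].

(** Symbol 1 fills the gaps of the first row, and each gap raises the depth limit [vD] by one above
    d_1. *)
Definition start : cmd := block [::
  Assign vD (Get1 aD (Cst 0));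
  Assign vJ (Cst 0);
  For vJ vL (block [::
    Assign vS (Get aS (Cst 0) (Var vJ));
    If (Var vS) (Cst 1)
      (block [:: Assign vS (Cst 1); Assign vD (Plus (Var vD) (Cst 1))]) Skip;
    update])].

(** With an empty alphabet and at least one column there is no vector at all, and the filler 1 would
    not be a symbol; the search is then skipped, leaving answer 0. *)
Definition main : cmd := block [::
  read_input;
  start;
  If (Cst 0) (Var vL) (If (Var vSg) (Cst 1) (Assign vMode (Cst 2)) Skip) Skip;
  While (Var vMode) (Cst 2) search].

(** * Correctness and running time *)

Ltac rewrite_vars :=
  repeat match goal with
  | H : vars ?s ?x = _ |- context [vars ?s ?x] => rewrite H
  | H : arrs ?s ?a ?i ?j = _ |- context [arrs ?s ?a ?i ?j] => rewrite H
  end.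

Ltac solve_safe :=
  rewrite /=; rewrite_vars; repeat split; lia.

Ltac wp_step :=
  first [ apply: wp_skip
        | apply: wp_assign; [solve_safe | rewrite /=]
        | apply: wp_put; [solve_safe | solve_safe | rewrite /=]
        | apply: wp_seq ].

(** A child is granted [200 * n], of which moving down and up needs at most half; the rest absorbs
    the cost [3 * dm] of listing the branches of an inner node. *)
Fixpoint budget (n dm b : nat) : nat :=
  if b is b'.+1 then 100 * n + dm.+1 * (200 * n + budget n dm b') else 100 * n + 3 * dm.

(** The surplus [500 * n] carries the induction: the step needs [600 * n <= 300 * n * dm.+1], which
    is where [0 < dm] enters. *)
Lemma budget_pos n dm b :
  0 < n -> 0 < dm -> budget n dm b + 500 * n <= 600 * n * dm.+1 ^ b.+1.
Proof.
move=> n0 dm0; elim: b => [|b IH] /=; first by rewrite expn1; nia.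
rewrite expnS mulnCA; have := leq_mul (leqnn dm.+1) IH.
rewrite !mulnDr; nia.
Qed.

Lemma budget_zero n dm b : dm = 0 -> budget n dm b = 100 * n + b * (300 * n).
Proof. by move=> ->; elim: b => [|b IH] /=; lia. Qed.

Section Correctness.

Variables (X : seq nat) (L n l sg : nat).

Hypothesis hn : nth 0 X 0 = n.
Hypothesis hl : nth 0 X 1 = l.
Hypothesis hsg : nth 0 X 2 = sg.
Hypothesis hX : size X = 3 + n + n * l.
Hypothesis n_gt0 : 0 < n.

Let S i j := nth 0 X (3 + n + i * l + j).
Let d i := nth 0 X (3 + i).

Hypothesis hL : forall i, i < n -> 2 * size X + d i + 3 < L.

Let LX : 2 * size X + 3 < L.
Proof. by have := hL n_gt0; lia. Qed.

Let lX : l + n < size X.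
Proof. by rewrite hX; nia. Qed.

(** * Changing one symbol of the current vector *)

Definition ctx (s : state) : Prop :=
  [/\ vars s vN = n, vars s vL = l,
      (forall i j, i < n -> j < l -> arrs s aS i j = S i j) &
      (forall i, i < n -> arrs s aD i 0 = d i)].

Definition rowset (s : state) (i : nat) (E : pred nat) : Prop :=
  sset l (arrs s aA i) (arrs s aP i) (arrs s aM i 0) E.

Lemma update_row_spec s i j x E :
  ctx s -> i < n -> j < l -> vars s vI = i -> vars s vJ = j -> vars s vS = x ->
  rowset s i E ->
  wp X L update_row s 0 (fun s' k => [/\ k <= 20,
    rowset s' i (fun y => if y == j then (S i j != 0) && (S i j != x) else E y) &
    forall i' E', i' != i -> rowset s i' E' -> rowset s' i' E']).
Proof.
move=> [sN sL sS sD] Hi Hj sI sJ sS' HE; subst i j.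
have HS := sS (vars s vI) (vars s vJ) Hi Hj.
have [[B1 B2] Hm HP] := HE; have [Pj APj] := B2 (vars s vJ) Hj.
have HPj := HP (vars s vJ) Hj.
(* Covers the two cases in which the membership of the column is already right. *)
have keep (b : bool) : E (vars s vJ) = b ->
    rowset s (vars s vI) (fun y => if y == (vars s vJ) then b else E y).
  move=> Eb; apply: sset_ext HE => // y Hy.
  by case: eqP => // ->.
rewrite /update_row.
do 8 wp_step.
apply: wp_seq.
pose want := (S (vars s vI) (vars s vJ) != 0) && (S (vars s vI) (vars s vJ) != x).
set s1 := setv _ vC 0.
have Hwant : wp X L (If (Cst 0) (Var vX)
     (If (Var vX) (Var vS) (Assign vC (Cst 1))
        (If (Var vS) (Var vX) (Assign vC (Cst 1)) Skip)) Skip) s1 4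
     (fun s2 k => k <= 8 /\ s2 = if want then setv s1 vC 1 else s1).
  rewrite /want; apply: wp_if => //=; rewrite HS => h; last first.
    by wp_step; split=> //; rewrite ifN //; lia.
  apply: wp_if => //=; rewrite HS sS' => h1.
    by wp_step; split=> //; rewrite ifT //; lia.
  apply: wp_if => //=; rewrite HS sS' => h2; wp_step; split=> //.
    by rewrite ifT //; lia.
  by rewrite ifN //; lia.
apply: (wp_conseq Hwant) => s2 t [Ht E2] _.
apply: wp_seq.
case: (boolP want) E2 => want1 E2.
  apply: wp_if; [by []|by []|move=> _|by rewrite E2].
  apply: wp_if; [by []|by []| |]; rewrite E2 /= => h.
    do 2 wp_step; split=> //; first by lia.
    by apply: (keep want); rewrite -HPj want1 h.
  have Hq : arrs s aM (vars s vI) 0 < l by lia.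
  have [Aq _] := B1 _ Hq.
  repeat wp_step; split; first by lia.
    have := sset_insert HE Hj h.
    apply: sset_ext => [y|y||y _] /=; rewrite ?eqxx /= ?addn1 //.
    by rewrite -/want want1.
  move=> i' E' ne; apply: sset_ext => [y|y||y _] //=; by rewrite (negPf ne).
apply: wp_if; [by []|by []|by rewrite E2|move=> _].
apply: wp_if; [by []|by []| |]; rewrite E2 /= => h; last first.
  do 2 wp_step; split=> //; first by lia.
  by apply: (keep want); rewrite -HPj (negPf want1) ltnNge h.
(* The column is a member, so the set is nonempty and its last slot is the size minus one. *)
have Hq : (arrs s aM (vars s vI) 0).-1.+1 = arrs s aM (vars s vI) 0 by lia.
have [Aq _] := B1 (arrs s aM (vars s vI) 0).-1 ltac:(lia).
rewrite -subn1 in Hq Aq.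
repeat wp_step; split; first by lia.
  rewrite /rowset -Hq in HE; rewrite -Hq in h.
  have := sset_remove HE Hj h.
  apply: sset_ext => [y|y||y _] /=; rewrite ?eqxx //= ?Hq ?subn1 //.
  by rewrite -/want (negPf want1).
by move=> i' E' ne; apply: sset_ext => [y|y||y _] //=; rewrite (negPf ne).
Qed.

Lemma ctx_frame c s s' :
  frame c s s' ->
  [&& vN \notin modv c, vL \notin modv c, aS \notin moda c & aD \notin moda c] ->
  ctx s -> ctx s'.
Proof.
move=> [V A] /and4P[H1 H2 H3 H4] [sN sL sS sD].
by split; rewrite ?V ?A.
Qed.

(** The sets [E] are arbitrary because during initialisation they are not yet the mismatch sets of a
    full vector. *)
Lemma update_spec s k j x (E : nat -> pred nat) :
  ctx s -> j < l -> vars s vJ = j -> vars s vS = x ->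
  (forall i, i < n -> rowset s i (E i)) ->
  wp X L update s k (fun s' k' => [/\ k' <= k + (n * 22 + 3),
    forall y, y < l -> arrs s' aV y 0 = if y == j then x else arrs s aV y 0 &
    forall i, i < n -> rowset s' i
      (fun y => if y == j then (S i j != 0) && (S i j != x) else E i y)]).
Proof.
move=> Hc Hj sJ sS' HE; have [sN sL sS sD] := Hc.
rewrite /update; do 5 wp_step; set s1 := setv _ _ _.
have Hc1 : ctx s1 by [].
pose E' i y := if y == j then (S i j != 0) && (S i j != x) else E i y.
apply: (@wp_for X L _ _ _ s1 _ _
  (fun i s' => forall i', i' < n -> rowset s' i' (if i' < i then E' i' else E i'))
  n 20) => //.
- by lia.
- move=> i s2 Hi I2 s2I s2N Hf.
  have Hc2 : ctx s2 by apply: ctx_frame Hf _ Hc1.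
  have s2J : vars s2 vJ = j by rewrite Hf.1.
  have s2S : vars s2 vS = x by rewrite Hf.1.
  have := I2 i Hi; rewrite ltnn => HEi.
  have Hu := update_row_spec Hc2 Hi Hj s2I s2J s2S HEi.
  apply: (wp_conseq Hu) => s3 t [Ht H3 Ho] _; split=> // i' Hi'.
  case: (eqVneq i' i) => [->|ne]; first by rewrite ltnSn.
  have -> : (i' < i.+1) = (i' < i) by lia.
  by apply: Ho => //; apply: I2.
- move=> s2 t I2 _ Hf Ht; apply: wp_skip; split.
  + by lia.
  + move=> y Hy; rewrite Hf.2 //= sJ sS'.
    by case: eqVneq.
  + by move=> i Hi; have := I2 i Hi; rewrite Hi.
Qed.

(** Silent about the order inside the sparse sets, which backtracking need not restore. *)
Definition coherent (s : state) (v : nat -> nat) : Prop :=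
  (forall j, j < l -> arrs s aV j 0 = v j) /\
  (forall i, i < n -> rowset s i (miss S v i)).

Lemma update_coherent s k j x v :
  ctx s -> coherent s v -> j < l -> vars s vJ = j -> vars s vS = x ->
  wp X L update s k (fun s' k' => k' <= k + (n * 22 + 3) /\ coherent s' (upd v j x)).
Proof.
move=> Hc [Hv HE] Hj sJ sS.
apply: (wp_conseq (update_spec k Hc Hj sJ sS HE)) => s' t [Ht HV HR] _.
split=> //; split=> [y Hy|i Hi]; first by rewrite HV // Hv.
apply: sset_ext (HR i Hi) => // y Hy; rewrite /miss /upd.
by case: (eqVneq y j) => [->|_].
Qed.

Lemma coherent_dist s v i :
  coherent s v -> i < n -> arrs s aM i 0 = dist l S v i.
Proof. by move=> [_ H] /H /sset_card. Qed.

Lemma coherent_ext s s' v v' :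
  (forall a, a \in [:: aV; aA; aP; aM] -> arrs s' a = arrs s a) ->
  (forall j, j < l -> v' j = v j) ->
  coherent s v -> coherent s' v'.
Proof.
move=> HA Hv [H1 H2]; split=> [j Hj|i Hi]; first by rewrite HA // H1 // Hv.
rewrite /rowset !HA //; apply: sset_ext (H2 i Hi) => // j Hj.
by rewrite /miss Hv.
Qed.

(** * Exploration of the search tree *)

Variables (D dm : nat).

Hypothesis hD : D + 2 < L.
Hypothesis hdm : forall i, i < n -> d i <= dm.
Hypothesis hS : forall i j, i < n -> j < l -> S i j <= sg.

Definition inv (s : state) (v : nat -> nat) (t : nat) : Prop :=
  [/\ ctx s, vars s vD = D, coherent s v, vars s vT = t & t <= D].

(** The stack discipline that lets a node resume branching after a child's subtree has been
    processed. *)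
Definition saved (t : nat) (s s' : state) : Prop :=
  forall a, a \in [:: aList; aRow; aCnt; aLen; aOld] ->
  forall i x, i < t -> arrs s' a i x = arrs s a i x.

Lemma saved_trans t s1 s2 s3 : saved t s1 s2 -> saved t s2 s3 -> saved t s1 s3.
Proof. by move=> H1 H2 a Ha i x Hi; rewrite H2 ?H1. Qed.

Lemma savedW t t' s s' : t' <= t -> saved t s s' -> saved t' s s'.
Proof. by move=> Ht H a Ha i x Hi; rewrite H // (leq_trans Hi). Qed.

(** Refers to the vector of the node itself, so it holds again whenever a child has been undone. The
    bound [d r < l] keeps list indices within the row stride. *)
Definition pushed (s : state) (v : nat -> nat) (t r : nat) : Prop :=
  [/\ r < n, arrs s aRow t 0 = r, arrs s aLen t 0 = (d r).+1,
    d r < l /\ (forall c, c <= d r ->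
      arrs s aList t c < l /\ miss S v r (arrs s aList t c)) &
    forall c c', c <= d r -> c' <= d r ->
      arrs s aList t c = arrs s aList t c' -> c = c'].

Lemma rowset_prefix s i v k :
  rowset s i (miss S v i) -> k < arrs s aM i 0 ->
  [/\ k < l, (forall c, c <= k ->
     arrs s aA i c < l /\ miss S v i (arrs s aA i c)) &
    forall c c', c <= k -> c' <= k -> arrs s aA i c = arrs s aA i c' -> c = c'].
Proof.
move=> [[B1 B2] Hm HE] Hk; split=> [|c Hc|c c' Hc Hc' E]; first by lia.
  have [Ac PAc] := B1 c ltac:(lia); split=> //.
  by rewrite -HE // PAc; lia.
have [_ E1] := B1 c ltac:(lia); have [_ E2] := B1 c' ltac:(lia).
by rewrite -E1 E E2.
Qed.

Lemma visit_spec s v t :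
  inv s v t ->
  wp X L visit s 0 (fun s' k => k <= 4 * n + 3 * dm + 20 /\
    ([/\ vars s' vMode = 2, vars s' vAns = 1 & forall i, i < n -> dist l S v i <= d i]
    \/ [/\ [/\ inv s' v t, vars s' vMode = 1, vars s' vAns = vars s vAns & saved t s s'],
         arrs s' aCnt t 0 = 0 &
         exists r, [/\ r < n, d r < dist l S v r &
           (t = D /\ arrs s' aLen t 0 = 0) \/ (t < D /\ pushed s' v t r)]])).
Proof.
move=> [Hc sD Hv sT tD]; have [sN sL sS sd] := Hc.
rewrite /visit; do 5 wp_step; set s1 := setv _ vI 0.
apply: (@wp_for X L _ _ _ s1 _ _ (fun i s' =>
  (vars s' vR = n /\ forall i', i' < i -> dist l S v i' <= d i') \/
  (vars s' vR < n /\ d (vars s' vR) < dist l S v (vars s' vR))) n 2) => //.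
- by lia.
- by left; rewrite /= sN; split.
- move=> i s2 Hi I2 s2I s2N Hf.
  have s2d : arrs s2 aD i 0 = d i by rewrite Hf.2 //= sd.
  have s2M : arrs s2 aM i 0 = dist l S v i.
    by rewrite Hf.2 //= (coherent_dist Hv).
  apply: wp_if; [by rewrite /= s2I; repeat split; lia..| |] => /=;
    rewrite s2I s2d s2M => h.
    by wp_step; split=> //=; right; rewrite s2I.
  wp_step; split=> //=; case: I2 => [[E H]|[E H]]; [left|right]; split=> //.
  move=> i'; rewrite ltnS leq_eqVlt => /orP[/eqP->|] //; exact: H.
move=> s2 u I2 s2I Hf Hu.
have s2N : vars s2 vN = n by rewrite Hf.1.
have s2T : vars s2 vT = t by rewrite Hf.1.
have s2D : vars s2 vD = D by rewrite Hf.1.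
have Hc2 : ctx s2 by apply: (ctx_frame Hf).
have Hv2 : coherent s2 v.
  by apply: coherent_ext Hv => // a Ha; rewrite Hf.2.
have s2A : vars s2 vAns = vars s vAns by rewrite Hf.1.
have Hsv : saved t s s2 by move=> a Ha i x Hi; rewrite Hf.2.
have [s2N' s2L s2S s2d] := Hc2.
apply: wp_seq; apply: wp_if => //=; rewrite s2N => h; last first.
  repeat wp_step; split; first by lia.
  left; split=> // i Hi; case: I2 => [[_ H]|[H _]]; last by lia.
  exact: H.
case: I2 => [[E _]|[_ Hr]]; first by lia.
do 6 wp_step; apply: wp_seq.
apply: wp_if => //=; rewrite s2T s2D => ht; last first.
  repeat wp_step; split; first by lia.
  right; split=> //=.
  + split=> // a Ha i x Hi; rewrite -(Hsv a Ha) //.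
    move: Ha; rewrite !inE => /or4P[/eqP->|/eqP->|/eqP->|/orP[/eqP->|/eqP->]] //=;
    by rewrite (ltn_eqF Hi).
  + by rewrite !eqxx.
  + by exists (vars s2 vR); split=> //; left; rewrite !eqxx; split; [lia|].
have Hdr := hL h.
(* The stored size is the distance, which exceeds the radius; hence there are enough members to
   list. *)
have Hpre := rowset_prefix (Hv2.2 _ h).
rewrite (coherent_dist Hv2 h) in Hpre.
have [dl Hps Hinj] := Hpre _ Hr.
have s2dr := s2d _ h.
do 5 wp_step; rewrite s2dr.
set s3 := setv _ vC 0.
apply: (@wp_for X L _ _ _ s3 _ _ (fun c s' =>
  (forall c', c' < c -> arrs s' aList t c' = arrs s2 aA (vars s2 vR) c') /\
  (forall i x, i < t -> arrs s' aList i x = arrs s aList i x))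
  (d (vars s2 vR) + 1) 1) => //.
- by lia.
- by split=> // i x Hi; apply: Hsv.
- move=> c s4 Hlt [I1 I2] s4c s4len Hf3.
  have s4T : vars s4 vT = t by rewrite Hf3.1.
  have s4R : vars s4 vR = vars s2 vR by rewrite Hf3.1.
  have s4A : arrs s4 aA = arrs s2 aA by rewrite Hf3.2.
  apply: wp_put; [by rewrite /=; repeat split; lia..|split=> //=].
  rewrite s4T s4R s4c s4A; split=> [c' Hc'|i x Hi].
    rewrite eqxx /=; case: eqVneq => [-> //|ne]; apply: I1; lia.
  by rewrite (ltn_eqF Hi) /= I2.
move=> s4 u' [I1 I2] s4c Hf3 Hu'.
have s4T : vars s4 vT = t by rewrite Hf3.1.
have s4R : vars s4 vR = vars s2 vR by rewrite Hf3.1.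
have s4len : vars s4 vLen = d (vars s2 vR) + 1 by rewrite Hf3.1.
have s4a a : a != aList -> arrs s4 a = arrs s3 a.
  by move=> Ha; rewrite Hf3.2 //= inE.
have hdr := hdm h.
repeat wp_step; split; first by lia.
right; rewrite /= s4T s4R s4len; split.
- split=> //=; rewrite ?Hf3.1 //.
  + split=> //=; [by apply: (ctx_frame Hf3) | by rewrite Hf3.1 |].
    by apply: coherent_ext Hv2 => // a; rewrite !inE => /or4P[] /eqP-> /=;
      rewrite s4a.
  + rewrite /saved => a Ha i x Hi; rewrite -(Hsv a Ha i x Hi).
    move: Ha; rewrite !inE => /or4P[/eqP->|/eqP->|/eqP->|/orP[/eqP->|/eqP->]] /=;
      first (by rewrite I2 // Hsv);
      by rewrite ?(ltn_eqF Hi) /= s4a //= ?(ltn_eqF Hi).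
- by rewrite s4a //= !eqxx.
exists (vars s2 vR); split=> //; right; split=> //; split=> //=.
- by rewrite !eqxx.
- by rewrite !eqxx addn1.
- by split=> // c Hlt; rewrite I1 ?addn1 //; apply: Hps.
- by move=> c c' H1 H2; rewrite !I1 ?addn1 //; apply: Hinj.
Qed.

Lemma descend_spec s v t r :
  inv s v t -> t < D -> pushed s v t r -> arrs s aCnt t 0 <= d r ->
  let j := arrs s aList t (arrs s aCnt t 0) in
  wp X L advance s 0 (fun s' k => k <= 22 * n + 15 /\
    [/\ [/\ inv s' (upd v j (S r j)) t.+1, vars s' vMode = 0,
          vars s' vAns = vars s vAns & saved t s s'],
       (forall a, a \in [:: aList; aRow; aCnt; aLen] -> arrs s' a = arrs s a) &
       arrs s' aOld t 0 = v j]).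
Proof.
move=> [Hc sD Hv sT tD] ht [Hr sRow sLen [dl Hps] _] Hcnt j.
have [sN sL sS sd] := Hc; have [Hj _] := Hps _ Hcnt; rewrite -/j in Hj.
have jE : arrs s aList t (arrs s aCnt t 0) = j by [].
apply: wp_if; [by rewrite /=; repeat split; lia..| |] => /=; rewrite sT sLen => h;
  last by lia.
do 2 wp_step; rewrite sT jE.
do 4 wp_step; rewrite sT sRow.
rewrite (sS r j Hr Hj); set s1 := setv _ vS _.
have Hc1 : ctx s1 by [].
have Hv1 : coherent s1 v by [].
apply: wp_seq.
apply: (wp_conseq (update_coherent 4 Hc1 Hv1 Hj erefl erefl)) => s2 u [Hu Hv2] Hf.
have s2T : vars s2 vT = t by rewrite Hf.1.
repeat wp_step; split; first by lia.
split; last by rewrite Hf.2 //= !eqxx /= Hv.1.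
  split=> //=; first split => //=.
  - by apply: (ctx_frame Hf).
  - by rewrite Hf.1.
  - by rewrite s2T addn1.
  - by rewrite Hf.1.
  - move=> a Ha i x Hi; move: Ha.
    rewrite !inE => /or4P[/eqP->|/eqP->|/eqP->|/orP[/eqP->|/eqP->]] /=;
      by rewrite Hf.2 //= (ltn_eqF Hi).
by move=> a; rewrite !inE => /or4P[] /eqP-> /=; rewrite Hf.2.
Qed.

Lemma ascend_spec s v t :
  inv s v t.+1 -> arrs s aLen t.+1 0 <= arrs s aCnt t.+1 0 ->
  vars s vMode = 1 ->
  let c := arrs s aCnt t 0 in let j := arrs s aList t c in
  c <= l -> j < l ->
  wp X L advance s 0 (fun s' k => k <= 22 * n + 15 /\
    [/\ [/\ inv s' (upd v j (arrs s aOld t 0)) t, vars s' vMode = 1,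
          vars s' vAns = vars s vAns & saved t s s'],
       (forall a, a \in [:: aList; aRow; aLen] -> arrs s' a = arrs s a) &
       arrs s' aCnt t 0 = c.+1]).
Proof.
move=> [Hc sD Hv sT tD] Hle sM c j Hcl Hj.
have [sN sL sS sd] := Hc.
have jE : arrs s aList t (arrs s aCnt t 0) = j by [].
have cE : arrs s aCnt t 0 = c by [].
apply: wp_if; [by rewrite /=; repeat split; lia..| |] => /=; rewrite sT => h;
  first by lia.
apply: wp_if => //=; rewrite sT => h'; last by lia.
do 2 wp_step; rewrite sT subSS subn0.
do 2 wp_step; rewrite jE.
do 2 wp_step; set s1 := setv _ vS _.
have Hc1 : ctx s1 by [].
have Hv1 : coherent s1 v by [].
apply: wp_seq.
apply: (wp_conseq (update_coherent 5 Hc1 Hv1 Hj erefl erefl)) => s2 u [Hu Hv2] Hf.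
have s2T : vars s2 vT = t by rewrite Hf.1.
have s2C : arrs s2 aCnt = arrs s aCnt by rewrite Hf.2.
have s2C' : arrs s2 aCnt t 0 = c by rewrite s2C.
repeat wp_step; rewrite s2T s2C'; split; first by lia.
split; last by rewrite /= !eqxx /= addn1.
  split=> //=; first split => //=.
  - by apply: (ctx_frame Hf).
  - by rewrite Hf.1.
  - by lia.
  - by rewrite Hf.1.
  - by rewrite Hf.1.
  - move=> a Ha i x Hi; move: Ha.
    rewrite !inE => /or4P[/eqP->|/eqP->|/eqP->|/orP[/eqP->|/eqP->]] /=;
      by rewrite ?(ltn_eqF Hi) Hf.2.
by move=> a; rewrite !inE => /or3P[] /eqP-> /=; rewrite Hf.2.
Qed.

Lemma inv_ext s v v' t :
  (forall j, j < l -> v' j = v j) -> inv s v t -> inv s v' t.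
Proof. by move=> E [Hc sD Hv sT tD]; split=> //; apply: coherent_ext Hv. Qed.

Lemma pushed_ext s s' v t r :
  (forall a, a \in [:: aList; aRow; aLen] -> forall x, arrs s' a t x = arrs s a t x) ->
  pushed s v t r -> pushed s' v t r.
Proof.
move=> E [Hr sRow sLen [dl Hps] Hinj]; split; rewrite ?E //.
  by split=> // c Hc; rewrite E //; apply: Hps.
by move=> c c' Hc Hc'; rewrite !E //; apply: Hinj.
Qed.

Definition reach := iters X L (Var vMode) (Cst 2) search.

(** The two extra units are the loop test and the dispatch on [vMode]. *)
Lemma reach_visit s (Q : state -> nat -> Prop) :
  vars s vMode = 0 -> wp X L visit s 0 Q ->
  exists s' k, reach s s' k.+2 /\ Q s' k.
Proof.
move=> sM [s' [k [He q]]]; exists s', k; split=> //.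
rewrite -(addn0 k.+1); apply: ItersS (Iters0 _ _ _ _ _ _) => //=; rewrite ?sM //.
by apply: ExecIf => //=; rewrite sM.
Qed.

Lemma reach_advance s (Q : state -> nat -> Prop) :
  vars s vMode = 1 -> wp X L advance s 0 Q ->
  exists s' k, reach s s' k.+2 /\ Q s' k.
Proof.
move=> sM [s' [k [He q]]]; exists s', k; split=> //.
rewrite -(addn0 k.+1); apply: ItersS (Iters0 _ _ _ _ _ _) => //=; rewrite ?sM //.
by apply: ExecIf => //=; rewrite sM.
Qed.

Definition found (s : state) : Prop :=
  [/\ vars s vMode = 2, vars s vAns = 1 & exists u, solution n l sg S d u].

(** Taken just before [advance] leaves the level, since what follows depends on whether [t] is the
    root. *)
Definition exhausted (s s' : state) (v : nat -> nat) (t b : nat) : Prop :=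
  [/\ inv s' v t, vars s' vMode = 1, vars s' vAns = vars s vAns,
      arrs s' aLen t 0 <= arrs s' aCnt t 0 & nosol n l sg S d b v].

Definition explores (t b : nat) : Prop := forall s v,
  inv s v t -> valid l sg v -> vars s vMode = 0 ->
  exists s' k, [/\ reach s s' k, k <= budget n dm b &
    found s' \/ (exhausted s s' v t b /\ saved t s s')].

(** Induction on the number [m] of branches left, the branches already undone being refuted by
    hypothesis. One branch is a descent, a subtree and an ascent. *)
Lemma explore_children b t r m s v :
  explores t.+1 b ->
  inv s v t -> valid l sg v -> t < D -> vars s vMode = 1 -> pushed s v t r ->
  arrs s aCnt t 0 + m = (d r).+1 ->
  (forall c, c < arrs s aCnt t 0 ->
     nosol n l sg S d b (upd v (arrs s aList t c) (S r (arrs s aList t c)))) ->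
  exists s' k, [/\ reach s s' k, k <= m * (100 * n + budget n dm b) &
    found s' \/ (exhausted s s' v t b.+1 /\ saved t s s')].
Proof.
move=> IH; elim: m s => [|m IHm] s Hinv Hval ht sM Hp Hcnt Hno.
  exists s, 0; split=> //; first exact: Iters0.
  right; have [Hr _ sLen [_ Hps] Hinj] := Hp.
  rewrite addn0 in Hcnt; split=> //; split=> //; first by rewrite sLen Hcnt.
  apply: (nosol_branch Hr Hps Hinj) => c Hc.
  by apply: Hno; rewrite Hcnt.
have Hc : arrs s aCnt t 0 <= d r by lia.
have [Hr sRow sLen [dl Hps] _] := Hp.
pose j := arrs s aList t (arrs s aCnt t 0).
have [Hj Hmiss] := Hps _ Hc; rewrite -/j in Hj Hmiss.
have [s1 [k1 [R1 [Hk1 [[Hinv1 s1M s1A Hs1] Ha1 s1O]]]]] :=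
  reach_advance sM (descend_spec Hinv ht Hp Hc).
rewrite -/j in Hinv1 s1O.
(* A listed position is a mismatch, so the entry of row [r] there is known and is a genuine
   symbol. *)
have Hval1 : valid l sg (upd v j (S r j)).
  move=> y Hy; rewrite /upd; case: eqP => _; last exact: Hval.
  by case/andP: Hmiss => H _; rewrite lt0n H hS.
have [s2 [k2 [R2 Hk2 H2]]] := IH s1 _ Hinv1 Hval1 s1M.
case: H2 => [Hf|[[Hinv2 s2M s2A Hle Hno2] Hs2]].
  exists s2, (k1.+2 + k2); split=> //; [exact: iters_trans R1 R2| |by left].
  by rewrite mulSn; lia.
have Hs02 : saved t s s2 by apply: saved_trans Hs1 (savedW _ Hs2).
have same a x : a \in [:: aList; aRow; aCnt; aLen] -> arrs s2 a t x = arrs s a t x.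
  move=> Ha; rewrite Hs2 ?ltnSn ?Ha1 //.
  by move: Ha; rewrite !inE => /or4P[] ->; rewrite ?orbT.
have jE2 : arrs s2 aList t (arrs s2 aCnt t 0) = j by rewrite !same.
have Hc2 : arrs s2 aCnt t 0 <= l by rewrite same //; lia.
have Hj2 : arrs s2 aList t (arrs s2 aCnt t 0) < l by rewrite jE2.
have [s3 [k3 [R3 [Hk3 [[Hinv3 s3M s3A Hs3] Ha3 s3C]]]]] :=
  reach_advance s2M (ascend_spec Hinv2 Hle s2M Hc2 Hj2).
(* The overwritten symbol lies at level [t], below the child's level, so it survived the subtree and
   the vector becomes [v] again. *)
rewrite jE2 Hs2 // s1O in Hinv3; rewrite same // in s3C.
have {}Hinv3 : inv s3 v t.
  apply: inv_ext Hinv3 => y _; rewrite /upd.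
  by case: eqP => [->|].
have sameL x : arrs s3 aList t x = arrs s aList t x by rewrite Ha3 // same.
have Hp3 : pushed s3 v t r.
  apply: pushed_ext Hp => a Ha x; rewrite Ha3 // same //.
  by move: Ha; rewrite !inE => /or3P[] ->; rewrite ?orbT.
have [||s4 [k4 [R4 Hk4 H4]]] := IHm s3 Hinv3 Hval ht s3M Hp3.
- by rewrite s3C; lia.
- move=> c; rewrite s3C ltnS leq_eqVlt sameL => /orP[/eqP->|]; last exact: Hno.
  exact: Hno2.
exists s4, (k1.+2 + (k2 + (k3.+2 + k4))); split.
- by apply: iters_trans R1 (iters_trans R2 (iters_trans R3 R4)).
- by rewrite mulSn; lia.
- case: H4 => [|[[H41 H42 H43 H44 H45] Hs4]]; [by left | right; split].
    by split=> //; rewrite H43 s3A s2A s1A.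
  exact: saved_trans Hs02 (saved_trans Hs3 Hs4).
Qed.

(** A leaf refutes only Hamming distance 0; each level above it gains one through [nosol_branch]. *)
Lemma explore b t : t + b = D -> explores t b.
Proof.
elim: b t => [|b IH] t Ht s v Hinv Hval sM.
all: have [s1 [k1 [R1 [Hk1 H1]]]] := reach_visit sM (visit_spec Hinv).
all: case: H1 => [[s1M s1A Hd]|[[Hinv1 s1M s1A Hs1] s1C [r [Hr Hviol H1]]]];
  first by exists s1, k1.+2; split=> //;
    [rewrite /=; nia | left; split=> //; exists v].
- case: H1 => [[_ s1L]|[]]; last by lia.
  exists s1, k1.+2; split=> //; first by rewrite /=; lia.
  right; split=> //; split=> //; first by rewrite s1L s1C.
  exact: nosol0 Hr Hviol.
- case: H1 => [[]|[ht Hp]]; first by lia.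
  have IHt : explores t.+1 b by apply: IH; lia.
  have [||s2 [k2 [R2 Hk2 H2]]] :=
      explore_children (m := (d r).+1) IHt Hinv1 Hval ht s1M Hp.
  + by rewrite s1C.
  + by move=> c; rewrite s1C.
  exists s2, (k1.+2 + k2); split; first exact: iters_trans R1 R2.
    have hdr : (d r).+1 <= dm.+1 by rewrite ltnS hdm.
    have := leq_mul hdr (leqnn (100 * n + budget n dm b)).
    by rewrite /=; nia.
  case: H2 => [|[[H1 H2 H3 H4 H5] Hs2]]; [by left | right; split].
    by split=> //; rewrite H3.
  exact: saved_trans Hs1 Hs2.
Qed.

(** * Reading the input, the initial vector and the whole program *)

Lemma rowset0 s i :
  (forall x, x < l -> arrs s aA i x = x) -> (forall x, x < l -> arrs s aP i x = x) ->
  arrs s aM i 0 = 0 -> rowset s i pred0.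
Proof.
move=> HA HP HM; split; rewrite ?HM //.
by split=> x Hx; rewrite ?HA // ?HP // ?HA.
Qed.

Lemma read_input_spec :
  wp X L read_input state0 0 (fun s k => [/\ k <= 20 * (n * l) + 20 * n,
    ctx s /\ vars s vSg = sg, [/\ vars s vMode = 0, vars s vAns = 0 & vars s vT = 0] &
    forall i, i < n -> rowset s i pred0]).
Proof.
rewrite /read_input.
do 5 (apply: wp_seq; apply: wp_assign; [by rewrite /=; repeat split; lia|];
      rewrite [eval _ _ _]/= ?hn ?hl ?hsg).
set s1 := setv _ vI 0; apply: wp_seq.
apply: (@wp_for X L _ _ _ s1 _ _ (fun i s => vars s vP = 3 + i /\
  forall i', i' < i -> arrs s aD i' 0 = d i') n 2) => //.
- by lia.
- move=> i s2 Hi [I1 I2] s2I s2N Hf.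
  repeat wp_step; rewrite s2I I1 addn1; split=> //; split=> [//|i' Hi'].
  rewrite andbT; case: eqVneq => [->//|ne]; apply: I2; lia.
move=> s2 t2 [I1 I2] s2I Hf2 Ht2.
have s2N : vars s2 vN = n by rewrite Hf2.1.
have s2L : vars s2 vL = l by rewrite Hf2.1.
do 2 wp_step; set s3 := setv _ vI 0; apply: wp_seq.
pose inv2 i j s := vars s vP = 3 + n + i * l + j /\
  forall i' j', i' < n -> j' < l -> (i' < i) || ((i' == i) && (j' < j)) ->
  [/\ arrs s aS i' j' = S i' j', arrs s aA i' j' = j' & arrs s aP i' j' = j'].
apply: (@wp_for X L _ _ _ s3 _ _ (fun i s => inv2 i 0 s) n (l * 6 + 2)) => //.
- by lia.
- split=> [|i' j' _ _]; first by rewrite /= I1; lia.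
  by rewrite ltn0 andbF.
- move=> i s4 Hi I4 s4I s4N Hf4.
  have s4L : vars s4 vL = l by rewrite Hf4.1.
  do 2 wp_step; set s5 := setv _ vJ 0; apply: wp_seq.
  apply: (@wp_for X L _ _ _ s5 _ _ (fun j s => inv2 i j s) l 4) => //.
  + by lia.
  + move=> j s6 Hj [I61 I62] s6J s6L Hf6.
    have s6I : vars s6 vI = i by rewrite Hf6.1.
    have Hp : 3 + n + i * l + j < size X by rewrite hX; nia.
    repeat wp_step; rewrite s6I s6J I61; split=> //; split=> [|i' j' Hi' Hj' Hor] /=.
      by lia.
    case: (boolP ((i' == i) && (j' == j))) => [/andP[/eqP-> /eqP->]|ne] //.
    by apply: I62 => //; lia.
  + move=> s6 t6 [I61 I62] s6J Hf6 Ht6; apply: wp_skip; split; last by lia.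
    split=> [|i' j' Hi' Hj' Hor]; first by rewrite /= I61; lia.
    by apply: I62 => //; lia.
move=> s4 t4 [_ I4] s4I Hf4 Ht4; apply: wp_skip; split.
- by nia.
- split; last by rewrite Hf4.1 //= Hf2.1.
  split; try by rewrite Hf4.1 //= Hf2.1.
    by move=> i j Hi Hj; have [] := I4 i j Hi Hj; rewrite ?Hi.
  by move=> i Hi; rewrite Hf4.2 //= I2.
- by split; rewrite Hf4.1 //= Hf2.1.
- move=> i Hi; apply: rowset0.
  + by move=> j Hj; have [] := I4 i j Hi Hj; rewrite ?Hi.
  + by move=> j Hj; have [] := I4 i j Hi Hj; rewrite ?Hi.
  + by rewrite Hf4.2 //= Hf2.2.
Qed.

Definition filled (j : nat) : nat := if S 0 j == 0 then 1 else S 0 j.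

(** Counted over a prefix to serve as the loop invariant for [vD] in [start]. *)
Definition missing (j : nat) : nat := #|[set x : 'I_l | (x < j) && (S 0 x == 0)]|.

Lemma missing0 : missing 0 = 0.
Proof. by apply/eqP; rewrite cards_eq0; apply/eqP/setP=> x; rewrite !inE. Qed.

Lemma missingS j : j < l -> missing j.+1 = missing j + (S 0 j == 0).
Proof.
move=> Hj; rewrite /missing (cardsD1 (Ordinal Hj)) inE /= ltnSn addnC.
congr (_ + _); apply: eq_card => x; rewrite !inE -val_eqE /=.
by case: ltngtP => //=; lia.
Qed.

Hypothesis hDE : D = d 0 + missing l.

Lemma missing_le j : missing j <= missing l.
Proof.
apply/subset_leq_card/subsetP=> x; rewrite !inE => /andP[_ ->].
by rewrite ltn_ord.
Qed.

Lemma start_spec s k :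
  ctx s -> (forall i, i < n -> rowset s i pred0) -> vars s vT = 0 ->
  wp X L start s k (fun s' k' => k' <= k + 40 * (n * l) + 20 * n /\ inv s' filled 0).
Proof.
move=> Hc HR sT; have [sN sL sS sd] := Hc; have sd0 := sd 0 n_gt0.
rewrite /start; do 4 wp_step; set s1 := setv _ vJ 0; apply: wp_seq.
(* Columns from [j] on have no symbol yet and belong to no mismatch set. *)
apply: (@wp_for X L _ _ _ s1 _ _ (fun j s => [/\ vars s vD = d 0 + missing j,
   forall x, x < j -> arrs s aV x 0 = filled x &
   forall i, i < n -> rowset s i (fun y => (y < j) && miss S filled i y)])
   l (22 * n + 10)) => //.
- by lia.
- split=> //=; first by rewrite sd0 missing0 addn0.
- move=> j s2 Hj [I1 I2 I3] s2J s2L Hf.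
  have Hc2 : ctx s2 by apply: (ctx_frame Hf).
  have [s2N _ s2S _] := Hc2.
  do 2 wp_step; rewrite s2J s2S //.
  set s3 := setv _ vS _.
  apply: wp_seq.
  have Hw : wp X L (If (Var vS) (Cst 1)
      (block [:: Assign vS (Cst 1); Assign vD (Plus (Var vD) (Cst 1))]) Skip) s3 1
    (fun s4 k => [/\ k <= 4, ctx s4 /\ vars s4 vJ = j, vars s4 vS = filled j,
      vars s4 vD = d 0 + missing j.+1 & arrs s4 = arrs s2]).
    have hm := missing_le j.
    rewrite missingS // /filled.
    apply: wp_if => //= h.
      repeat wp_step; split=> //=; first by rewrite ifT //; lia.
      by have -> : S 0 j == 0 by [lia]; lia.
    wp_step; split=> //=; first by rewrite ifN //; lia.
    by have -> : S 0 j == 0 = false by [lia]; rewrite addn0.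
  apply: (wp_conseq Hw) => s4 t4 [Ht4 [Hc4 s4J] s4S s4D s4A] _.
  apply: wp_seq.
  have HR4 i : i < n -> rowset s4 i (fun y => (y < j) && miss S filled i y).
    by move=> Hi; rewrite /rowset s4A; apply: I3.
  apply: (wp_conseq (update_spec (1 + t4) Hc4 Hj s4J s4S HR4)) => s5 t5 [Ht5 H1 H2] Hf5.
  apply: wp_skip; split; last by lia.
  split=> //=; first by rewrite Hf5.1.
    move=> x Hx; rewrite H1 ?s4A; last by lia.
    by case: eqVneq => [->//|ne]; apply: I2; lia.
  move=> i Hi; apply: sset_ext (H2 i Hi) => // y Hy; rewrite /miss.
  case: (eqVneq y j) => [->|ne]; first by rewrite ltnSn.
  by have -> : (y < j.+1) = (y < j) by lia.
move=> s2 t2 [I1 I2 I3] s2J Hf Ht; apply: wp_skip; split; first by nia.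
split=> //.
- by apply: (ctx_frame Hf).
- by rewrite I1.
- split=> // i Hi; apply: sset_ext (I3 i Hi) => // y Hy.
  by rewrite Hy.
- by rewrite Hf.1.
Qed.

(** Where [u] leaves the filled row, the entry was either missing or a known mismatch with [u]. For
    a solution the bound is at most [D], so refuting distance [D] at the root excludes all
    solutions. *)
Lemma ham_filled u : ham l u filled <= dist l S u 0 + missing l.
Proof.
rewrite /ham /dist /missing; apply: leq_trans (leq_card_setU _ _).
apply/subset_leq_card/subsetP=> x; rewrite !inE ltn_ord /miss /filled /=.
case: (eqVneq (S 0 x) 0) => [_ _|_ H]; first by rewrite orbT.
by rewrite eq_sym H.
Qed.

Lemma stop_spec s v :
  inv s v 0 -> arrs s aLen 0 0 <= arrs s aCnt 0 0 ->
  wp X L advance s 0 (fun s' k =>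
    [/\ k <= 3, vars s' vMode = 2 & vars s' vAns = vars s vAns]).
Proof.
move=> [Hc sD Hv sT tD] h.
apply: wp_if; [by rewrite /= sT; repeat split; lia..| |] => /=; rewrite sT => h1;
  first by lia.
by apply: wp_if => //=; rewrite sT => h2; wp_step.
Qed.

Lemma search_spec s :
  inv s filled 0 -> valid l sg filled -> vars s vMode = 0 -> vars s vAns = 0 ->
  exists s' t, [/\ exec X L (While (Var vMode) (Cst 2) search) s s' t,
    t <= budget n dm D + 10 &
    (vars s' vAns = 1 /\ exists u, solution n l sg S d u) \/
    (vars s' vAns = 0 /\ forall u, ~ solution n l sg S d u)].
Proof.
move=> Hinv Hval sM sA.
have [s1 [t1 [R1 Ht1 H1]]] := explore (add0n D) Hinv Hval sM.
case: H1 => [[s1M s1A Hu]|[[Hinv1 s1M s1A Hle Hno] _]].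
  exists s1, t1.+1; split; [|by lia|by left].
  by apply: iters_exec R1 _ _ _ => //=; rewrite s1M.
have [s2 [t2 [R2 [Ht2 s2M s2A]]]] := reach_advance s1M (stop_spec Hinv1 Hle).
exists s2, (t1 + t2.+2).+1; split; [|by lia|].
  by apply: iters_exec (iters_trans R1 R2) _ _ _ => //=; rewrite s2M.
right; split=> [|u Hu]; first by rewrite s2A s1A.
apply: (Hno u Hu); apply: leq_trans (ham_filled u) _.
by rewrite hDE leq_add2r; apply: Hu.2.
Qed.

Lemma main_spec : exists s t, [/\ exec X L main state0 s t,
  t <= 60 * (n * l) + 60 * n + budget n dm D &
  (vars s vAns = 1 /\ exists u, solution n l sg S d u) \/
  (vars s vAns = 0 /\ forall u, ~ solution n l sg S d u)].
Proof.
suff [s [t [H1 [H2 H3]]]] : wp X L main state0 0 (fun s t =>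
  t <= 60 * (n * l) + 60 * n + budget n dm D /\
  ((vars s vAns = 1 /\ exists u, solution n l sg S d u) \/
  (vars s vAns = 0 /\ forall u, ~ solution n l sg S d u))).
  by exists s, t.
apply: wp_seq; apply: (wp_conseq read_input_spec) =>
  s1 t1 [Ht1 [Hc1 s1Sg] [s1M s1A s1T] HR] _.
apply: wp_seq; apply: (wp_conseq (start_spec t1 Hc1 HR s1T)) => s2 t2 [Ht2 Hinv] Hf.
have s2M : vars s2 vMode = 0 by rewrite Hf.1.
have s2A : vars s2 vAns = 0 by rewrite Hf.1.
have s2Sg : vars s2 vSg = sg by rewrite Hf.1.
have [[s2N s2L _ _] _ _ _ _] := Hinv.
have ok k : (l = 0 \/ 0 < sg) -> k <= t1 + t2 + 2 ->
    wp X L (Seq (While (Var vMode) (Cst 2) search) Skip) s2 k (fun s t =>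
      t <= 60 * (n * l) + 60 * n + budget n dm D /\
     ((vars s vAns = 1 /\ exists u, solution n l sg S d u) \/
     (vars s vAns = 0 /\ forall u, ~ solution n l sg S d u))).
  move=> H Hk; have Hval : valid l sg filled.
    move=> j Hj; rewrite /filled; have := hS n_gt0 Hj.
    case: (eqVneq (S 0 j) 0) => [_ _|ne ->]; last by rewrite lt0n ne.
    by case: H => [l0|//]; rewrite l0 in Hj.
  have [s3 [t3 [H1 H2 H3]]] := search_spec Hinv Hval s2M s2A.
  apply: wp_seq; exists s3, t3; split=> //; apply: wp_skip; split=> //.
  by lia.
apply: wp_seq; apply: wp_if => //=; rewrite s2L => hl0; last first.
  by apply: wp_skip; apply: ok; [left; lia | lia].
apply: wp_if => //=; rewrite s2Sg => hsg0; last first.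
  by apply: wp_skip; apply: ok; [right; lia | lia].
wp_step; apply: wp_seq; set s3 := setv _ _ _; exists s3, 1; split.
  exact: ExecWhileF.
apply: wp_skip; split; first by lia.
right; split=> // u [/(_ 0 hl0) Hu _]; lia.
Qed.

End Correctness.

(** * Encoded instances *)

Lemma nth_allpairs (T1 T2 T3 : Type) (f : T1 -> T2 -> T3) x1 x2 x3 s t i j :
  i < size s -> j < size t ->
  nth x3 [seq f a b | a <- s, b <- t] (i * size t + j) = f (nth x1 s i) (nth x2 t j).
Proof.
elim: s i => [//|a s IH] [|i] /= Hi Hj; rewrite nth_cat size_map.
  by rewrite Hj (nth_map x2).
by rewrite mulSn -addnA ltnNge leq_addr /= addKn IH.
Qed.

Section Encoding.

Variable (X : instance).

Let n := nrows X.
Let l := ncols X.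
Let sg := #|alphabet X|.
Let x := encode X.
Let S i j := nth 0 x (3 + n + i * l + j).
Let d i := nth 0 x (3 + i).

Lemma size_encode : size x = 3 + n + n * l.
Proof. by rewrite !size_cat size_allpairs size_map !size_enum_ord addnA. Qed.

Lemma nth_radius (i : 'I_n) : d i = radius i.
Proof.
rewrite /d /x /encode nth_cat /= nth_cat size_map size_enum_ord subSS.
have -> : 2 + i - 2 = i by lia.
by rewrite ltn_ord (nth_map i) ?size_enum_ord // nth_ord_enum.
Qed.

Lemma nth_entry (i : 'I_n) (j : 'I_l) : S i j = encode_entry (matrixS X i j).
Proof.
rewrite /S /x /encode nth_cat; case: ltnP => [/=|_]; first by lia.
rewrite nth_cat size_map size_enum_ord; case: ltnP => [/=|_]; first by lia.
have -> : 3 + n + i * l + j - size [:: n; l; #|alphabet X|] - n = i * l + j.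
  by rewrite /=; lia.
by rewrite -[l in i * l](size_enum_ord l) (nth_allpairs _ i j)
  ?size_enum_ord // !nth_ord_enum.
Qed.

(** Ranks shifted by one keep 0 free for missing entries and are injective, so equality of symbols
    is preserved. *)
Lemma delta_dist (v : 'rV[alphabet X]_l) (u : nat -> nat) (i : 'I_n) :
  (forall j : 'I_l, u j = (enum_rank (v ord0 j)).+1) ->
  delta (map_mx Some v) (row i (matrixS X)) = dist l S u i.
Proof.
move=> Hu; apply: eq_card => j; rewrite !inE !mxE /miss nth_entry Hu.
case: (matrixS X i j) => [b|] /=; last by [].
by rewrite andbT eqSS (inj_eq val_inj) (inj_eq enum_rank_inj) eq_sym.
Qed.

Lemma con_rmcP : reflect (exists u, solution n l sg S d u) (con_rmc X).
Proof.
apply: (iffP existsP) => [[v /forallP Hv]|[u [Hval Hu]]].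
  (* The default 0 is never inspected: only columns below [l] count. *)
  pose u j := if insub j is Some j' then (enum_rank (v ord0 (j' : 'I_l))).+1 else 0.
  have uE (j : 'I_l) : u j = (enum_rank (v ord0 j)).+1 by rewrite /u valK.
  exists u; split=> [j Hj|i Hi].
    by have /= -> := uE (Ordinal Hj); rewrite ltnS ltn_ord.
  have := Hv (Ordinal Hi); rewrite (delta_dist _ uE) => H.
  by rewrite -[d i]/(d (Ordinal Hi)) nth_radius.
have Hj (j : 'I_l) : (u j).-1 < #|alphabet X|.
  by have := Hval j (ltn_ord j); rewrite -/sg; lia.
exists (\row_j enum_val (Ordinal (Hj j)))%R; apply/forallP=> i.
rewrite (@delta_dist _ u) => [|j]; first by rewrite -nth_radius; apply: Hu.
rewrite mxE enum_valK /= prednK //.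
by have /andP[] := Hval j (ltn_ord j).
Qed.

Lemma radius_le i : i < n -> d i <= max_radius X.
Proof.
move=> Hi; rewrite -[i]/(val (Ordinal Hi)) nth_radius.
exact: (leq_bigmax (Ordinal Hi)).
Qed.

Lemma entry_le i j : i < n -> j < l -> S i j <= sg.
Proof.
move=> Hi Hj; rewrite -[i]/(val (Ordinal Hi)) -[j]/(val (Ordinal Hj)) nth_entry.
by case: (matrixS X _ _) => [b|//] /=; rewrite ltn_ord.
Qed.

Lemma missing_le_max : missing x n l l <= max_missing X.
Proof.
apply: leq_trans (leq_bigmax (Ordinal (nrows_gt0 X))).
rewrite /missing; apply/eq_leq/eq_card => j; rewrite !inE ltn_ord andTb.
rewrite -[nth _ _ _]/(S (Ordinal (nrows_gt0 X)) j) nth_entry.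
by case: (matrixS X _ _).
Qed.

End Encoding.

(** * Time and word-size estimates *)

Lemma magnitude_ge (s : seq nat) i : nth 0 s i <= magnitude s.
Proof.
rewrite leq_max; case: (ltnP i (size s)) => Hi; last by rewrite nth_default.
by rewrite (leq_bigmax_seq _ (mem_nth 0 Hi)) ?orbT.
Qed.

(** For [d = 0] the budget is linear in [D] and [D <= l] charges it to [n * l]; otherwise
    [budget_pos] applies. The constant is 60 + 60 + 600 + 1. *)
Lemma theorem_time n l d k t D :
  0 < n -> (d = 0 -> D <= l) -> D <= d + k ->
  t <= 60 * (n * l) + 60 * n + budget n d D ->
  t.+1 <= 721 * (n * l + (d + 1) ^ (d + k + 1) * n).
Proof.
move=> n_gt0 Dl HD Ht.
have f1 : n <= (d + 1) ^ (d + k + 1) * n.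
  by rewrite leq_pmull // expn_gt0 addn1.
case: (posnP d) => [d0|d_gt0].
  have := Dl d0; rewrite (budget_zero n D d0) in Ht.
  have : D * n <= n * l by rewrite mulnC leq_mul // Dl.
  by move: Ht f1; set P := _ ^ _ * n; lia.
have HB := budget_pos D n_gt0 d_gt0.
have HE : d.+1 ^ D.+1 <= (d + 1) ^ (d + k + 1).
  by rewrite !addn1 leq_pexp2l // ltnS.
have := leq_mul HE (leqnn (600 * n)).
move: Ht f1 HB; rewrite (mulnC (600 * n)) [_ * (600 * n)]mulnCA.
set P := _ * n; lia.
Qed.

(** Two factors [M] bound the product of the first index range and the row stride; the other three
    contribute at least 64, which outweighs the 44 and the lower-order terms. *)
Lemma word_size_suffices M N w :
  4 <= M -> N <= M -> M ^ 5 < 2 ^ w ->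
  [/\ 4 <= 2 ^ w, (4 * M * N).+1 * 11 + N + 11 <= 2 ^ w, 4 * M <= 2 ^ w &
      N < 2 ^ w].
Proof.
move=> M4 NM Mw; have HM : M ^ 5 = M * M * (M * M * M).
  by rewrite !expnS expn0; lia.
have H1 : 4 * 4 * 4 <= M * M * M by rewrite !leq_mul.
have H2 := leq_mul (leqnn (M * M)) H1.
have H3 : M * 4 <= M * M by rewrite leq_mul.
have H4 : M * N <= M * M by rewrite leq_mul.
by rewrite -mulnA; split; lia.
Qed.

Theorem theorem9 :
  solvable_in_bigO encode con_rmc
    (fun X : instance =>
       let n := nrows X in
       let l := ncols X in
       let d := max_radius X in
       let k := max_missing X in
       n * l + (d + 1) ^ (d + k + 1) * n).
Proof.
(* The program uses 17 variables and 11 arrays. *)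
exists (compile 17 11 main), 5, (size (compile 17 11 main) * 721) => X w Hw.
set n := nrows X in Hw *; set l := ncols X in Hw *; set x := encode X in Hw *.
set M := magnitude x in Hw *.
have n_gt0 : 0 < n := nrows_gt0 X.
have HX : size x = 3 + n + n * l := size_encode X.
have HM : size x <= M by apply: leq_maxl.
have dM i : nth 0 x i <= M by apply: magnitude_ge.
have Hl : l <= n * l by rewrite leq_pmull.
have HmM : missing x n l l <= l.
  by rewrite -[leqRHS]card_ord; apply: max_card.
have M4 : 4 <= M by lia.
(* [L = 4 * M] exceeds [2 * size x + d i + 3], as the length and each radius are at most [M] and
   [M >= 4]. *)
have [||s [t [He Ht Hres]]] := @main_spec x (4 * M) n l #|alphabet X|
    erefl erefl erefl HX n_gt0 _ (nth 0 x 3 + missing x n l l) (max_radius X) _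
    (@radius_le X) (@entry_le X) erefl.
- by move=> i _; have := dM (3 + i); lia.
- by have := dM 3; lia.
have Hb : vars s 0 = con_rmc X :> nat.
  by case: con_rmcP Hres => H [[-> Hu]|[-> Hu]] //; case: H => u; move/Hu.
have {}Ht : t.+1 <= 721 * (n * l +
    (max_radius X + 1) ^ (max_radius X + max_missing X + 1) * n).
  apply: (theorem_time n_gt0 _ _ Ht).
    by move=> d0; move: (radius_le n_gt0); rewrite d0 leqn0 => /eqP ->.
  by apply: leq_add (radius_le n_gt0) (missing_le_max X).
have [W4 W1 W2 W3] := word_size_suffices M4 HM Hw.
(* The largest constant in [main] is 3, so the bound 4 is enough. *)
have Hwf : wf 17 11 (2 ^ w) main by apply: (wf_mono W4).
have [t' Ht' H] := compile_decides (nv := 17) HX isT Hwf W1 W2 W3 He Hb.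
exists t' => //; apply: leq_trans Ht' _.
by rewrite -mulnA leq_mul2l Ht orbT.
Qed.
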